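(* Let $d, r \in \mathbb{N}$ be given. There exists an increasing function $h: \mathbb{N} \rightarrow \mathbb{N}$ such that the following are true for each $m \in \mathbb{N}_+$. (1) For every graph $G \in \mathrm{TM}_r(d)$, there exists $H \in \mathrm{TM}_r(d)$ such that: (i) $H$ is an induced subgraph of $G$; (ii) $|H|$ is at most $\mathsf{tower}(d, h(d) \cdot m \cdot (m + \log r))$; and (iii) $H \equiv_{\mathrm{MSO}[m]} G$. (2) The index of the $\equiv_{\mathrm{MSO}[m]}$ relation over $\mathrm{TM}_r(d)$ is at most $\mathsf{tower}(d+1, h(d) \cdot m^2 \cdot (\log r)^2)$.
   Context: All graphs are simple undirected graphs (structures over one irreflexive symmetric binary relation $E$) of arbitrary (finite or infinite) cardinality. A $p$-labeled rooted tree is a structure over $\{E, \mathsf{root}, P_1,\dots,P_p\}$ whose $E$-reduct is a tree, $\mathsf{root}$ is a singleton (the root), and the $P_i$ partition the nodes (some may be empty). For $r,d\in\mathbb{N}$, a tree model of $r$ labels and height $d$ is a pair $(t,S)$ where $t$ is an (arbitrary cardinality) $(r+1)$-labeled rooted tree and $S \subseteq [r]^2\times[d]$ (with $[n]=\{1,\dots,n\}$) such that: every root-to-leaf path in $t$ has length exactly $d$; each leaf has a label in $[r]$ and every internal node has label $r+1$; $(i,j,l)\in S$ iff $(j,i,l)\in S$. It is a tree model of the graph $G$ whose vertex set is the set of leaves of $t$ and where two leaves $u,v$ with labels $i,j$ at distance $2l$ in $t$ are adjacent iff $(i,j,l)\in S$. $\mathrm{TM}_r(d)$ denotes the class of all (finite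 or infinite) graphs isomorphic to a graph having a tree model of $r$ labels and height $d$. $|H|$ denotes the number of vertices. For structures $A,B$, $A \equiv_{\mathrm{MSO}[m]} B$ means that $A$ and $B$ satisfy the same monadic second-order sentences of quantifier rank at most $m$ (quantifier rank counts both first-order and set quantifiers); the index of this relation over a class is the number of its equivalence classes among structures of the class. $\mathsf{tower}(0,n)=n$ and $\mathsf{tower}(d,n)=2^{\mathsf{tower}(d-1,n)}$.
   Formalization: Here log r is read as max(1, log_2 r): with log 1 = 0 part (2) fails for r = 1 (for d = 1, m = 3 the cliques K_1, K_2, K_3 are pairwise inequivalent but tower(2,0) = 2), and log 0 is undefined; for r ≥ 2 it is log_2 r. *)

(* Defs.v *)
From Stdlib Require Import Reals List Arith.
Import ListNotations.
Open Scope R_scope.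

Record graph := {
  gV : Type;
  gE : gV -> gV -> Prop;
  gE_irr : forall x, ~ gE x x;
  gE_sym : forall x y, gE x y -> gE y x }.

Definition induced_sub (H G : graph) : Prop :=
  exists f : gV H -> gV G,
    (forall x y, f x = f y -> x = y) /\
    (forall x y, gE H x y <-> gE G (f x) (f y)).

Definition card_le (H : graph) (x : R) : Prop :=
  exists l : list (gV H), NoDup l /\ (forall v, In v l) /\ INR (length l) <= x.

Inductive walk {N : Type} (E : N -> N -> Prop) : N -> N -> nat -> Prop :=
| walk0 x : walk E x x 0
| walkS x y z n : E x y -> walk E y z n -> walk E x z (S n).

Definition dist {N : Type} (E : N -> N -> Prop) (x y : N) (n : nat) : Prop :=
  walk E x y n /\ forall k, walk E x y k -> (n <= k)%nat.

Fixpoint chain {N : Type} (E : N -> N -> Prop) (l : list N) : Prop :=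
  match l with
  | x :: ((y :: _) as t) => E x y /\ chain E t
  | _ => True
  end.

Definition has_cycle {N : Type} (E : N -> N -> Prop) : Prop :=
  exists (x : N) (l : list N),
    NoDup (x :: l) /\ (2 <= length l)%nat /\ chain E (x :: l) /\ E (last l x) x.

Definition is_tree {N : Type} (E : N -> N -> Prop) : Prop :=
  (forall x, ~ E x x) /\ (forall x y, E x y -> E y x) /\
  (forall x y, exists n, walk E x y n) /\ ~ has_cycle E.

Definition child {N : Type} (E : N -> N -> Prop) (root u v : N) : Prop :=
  E u v /\ exists n, dist E root u n /\ dist E root v (S n).

Definition leaf {N : Type} (E : N -> N -> Prop) (root v : N) : Prop :=
  ~ exists w, child E root v w.

(** (t, S) is a tree model of r labels and height d, where t = (N, E, root, lab)
    is an (r+1)-labeled rooted tree, lab v = i meaning v in P_i, and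
    S i j l meaning (i,j,l) in S. *)
Definition is_tree_model (r d : nat) {N : Type} (E : N -> N -> Prop) (root : N)
    (lab : N -> nat) (S : nat -> nat -> nat -> Prop) : Prop :=
  is_tree E /\
  (forall v, (1 <= lab v <= r + 1)%nat) /\
  (forall v, leaf E root v -> dist E root v d) /\
  (forall v, leaf E root v -> (1 <= lab v <= r)%nat) /\
  (forall v, ~ leaf E root v -> lab v = (r + 1)%nat) /\
  (forall i j l, S i j l -> (1 <= i <= r)%nat /\ (1 <= j <= r)%nat /\ (1 <= l <= d)%nat) /\
  (forall i j l, S i j l <-> S j i l).

Definition model_adj {N : Type} (E : N -> N -> Prop) (lab : N -> nat)
    (S : nat -> nat -> nat -> Prop) (u v : N) : Prop :=
  exists l, dist E u v (2 * l) /\ S (lab u) (lab v) l.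

Definition TM (r d : nat) (G : graph) : Prop :=
  exists (N : Type) (E : N -> N -> Prop) (root : N) (lab : N -> nat)
         (S : nat -> nat -> nat -> Prop),
    is_tree_model r d E root lab S /\
    exists f : gV G -> {v : N | leaf E root v},
      (forall x y, f x = f y -> x = y) /\
      (forall w, exists x, f x = w) /\
      (forall x y, gE G x y <-> model_adj E lab S (proj1_sig (f x)) (proj1_sig (f y))).

(* first-order variables and set variables are separate namespaces (nat) *)
Inductive mso : Type :=
| MEdge (x y : nat)
| MEq (x y : nat)
| MIn (x X : nat)
| MNot (p : mso)
| MAnd (p q : mso)
| MOr (p q : mso)
| MEx1 (x : nat) (p : mso)
| MAll1 (x : nat) (p : mso)
| MEx2 (X : nat) (p : mso)
| MAll2 (X : nat) (p : mso).

Definition upd {A : Type} (e : nat -> A) (x : nat) (a : A) : nat -> A :=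
  fun k => if Nat.eqb k x then a else e k.

Fixpoint sat (G : graph) (e1 : nat -> option (gV G)) (e2 : nat -> gV G -> Prop)
    (p : mso) : Prop :=
  match p with
  | MEdge x y => match e1 x, e1 y with Some a, Some b => gE G a b | _, _ => False end
  | MEq x y => match e1 x, e1 y with Some a, Some b => a = b | _, _ => False end
  | MIn x X => match e1 x with Some a => e2 X a | None => False end
  | MNot q => ~ sat G e1 e2 q
  | MAnd q s => sat G e1 e2 q /\ sat G e1 e2 s
  | MOr q s => sat G e1 e2 q \/ sat G e1 e2 s
  | MEx1 x q => exists a : gV G, sat G (upd e1 x (Some a)) e2 q
  | MAll1 x q => forall a : gV G, sat G (upd e1 x (Some a)) e2 q
  | MEx2 X q => exists A : gV G -> Prop, sat G e1 (upd e2 X A) q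
  | MAll2 X q => forall A : gV G -> Prop, sat G e1 (upd e2 X A) q
  end.

Fixpoint wf (b1 b2 : list nat) (p : mso) : Prop :=
  match p with
  | MEdge x y | MEq x y => In x b1 /\ In y b1
  | MIn x X => In x b1 /\ In X b2
  | MNot q => wf b1 b2 q
  | MAnd q s | MOr q s => wf b1 b2 q /\ wf b1 b2 s
  | MEx1 x q | MAll1 x q => wf (x :: b1) b2 q
  | MEx2 X q | MAll2 X q => wf b1 (X :: b2) q
  end.

Definition sentence (p : mso) : Prop := wf [] [] p.

Fixpoint qr (p : mso) : nat :=
  match p with
  | MEdge _ _ | MEq _ _ | MIn _ _ => 0
  | MNot q => qr q
  | MAnd q s | MOr q s => Nat.max (qr q) (qr s)
  | MEx1 _ q | MAll1 _ q | MEx2 _ q | MAll2 _ q => S (qr q)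
  end.

Definition sat_sentence (G : graph) (p : mso) : Prop :=
  sat G (fun _ => None) (fun _ _ => False) p.

Definition mso_equiv (m : nat) (A B : graph) : Prop :=
  forall p, sentence p -> (qr p <= m)%nat -> (sat_sentence A p <-> sat_sentence B p).

Definition mso_index_le (r d m : nat) (x : R) : Prop :=
  forall (n : nat) (Gs : nat -> graph),
    (forall i, (i < n)%nat -> TM r d (Gs i)) ->
    (forall i j, (i < n)%nat -> (j < n)%nat -> i <> j -> ~ mso_equiv m (Gs i) (Gs j)) ->
    INR n <= x.

Fixpoint tower (d : nat) (x : R) : R :=
  match d with
  | O => x
  | S d' => Rpower 2 (tower d' x)
  end.

(** log r : binary logarithm, read as max(1, log_2 r) *)
Definition logr (r : nat) : R := Rmax 1 (ln (INR r) / ln 2).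

(* Main.v *)
From Stdlib Require Import Reals Lra Lia Arith List Classical ClassicalEpsilon.
From Stdlib Require Import FunctionalExtensionality ProofIrrelevance Eqdep.
Require Import Defs.
Import ListNotations.
Local Open Scope nat_scope.

(** A tree model of height [d] is unfolded into a tree all of whose leaves have depth
    [d], on which adjacency of two leaves depends on their labels and the height at which
    they meet.  By recursion on the height, a coloured tree gets a type: the function
    counting, up to a threshold, the components of each type.  The threshold for [m + 1]
    moves exceeds the threshold for [m] moves times the number of types with one more
    colour, so that a set move in a tree can be answered in every tree of the same type:
    among more than that many components some refined type occurs often enough to absorb
    the surplus.  Hence equal types give MSO-equivalence (elements are played as singleton
    sets), and keeping only threshold many components of each type, recursively, gives the
    small induced subgraph [H].  Each level adds one exponential to the number of types,
    and the size of [H] is roughly the [(m + 1)]-st power of the number of types one level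
    below; this gives the towers.  The index is bounded by
    the number of adjacency matrices of the graphs [H]. *)

(** A position of the game is a pair of colourings of equal type. A move adds one bit to every
    colour, so [n] doubles while the number of rounds drops by one, and [n * 2 ^ m] stays constant.
    Starting from [r + 1] colours, its logarithm is of order [m + log r], which explains the
    argument of the towers. The other factor [m] of the size bound comes from the threshold,
    essentially a product of [m] numbers of types; in the count of types that factor disappears into
    the next exponential. A type says nothing about the set [S] of the model: equal types give
    equivalence only under a common adjacency rule. A graph and its pruned subgraph share that rule,
    two arbitrary members of the class need not. This is why the index is obtained from the graphs
    [H] and not directly from the number of types. *)

Lemma dep_choice {I : Type} {B : I -> Type} (Q : forall i, B i -> Prop) :
  (forall i, exists x, Q i x) -> exists f : forall i, B i, forall i, Q i (f i).
Proof.
  intros H.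
  exists (fun i => proj1_sig (constructive_indefinite_description _ (H i))).
  intros i. apply proj2_sig.
Qed.

Lemma least_witness (P : nat -> Prop) (n : nat) :
  P n -> exists k, k <= n /\ P k /\ forall j, j < k -> ~ P j.
Proof.
  revert n. induction n as [n IH] using lt_wf_ind. intros Hn.
  destruct (classic (exists j, j < n /\ P j)) as [[j [Hj HP]]|H].
  - destruct (IH j Hj HP) as [k [Hk [HPk Hm]]]. exists k. repeat split; auto. lia.
  - exists n. repeat split; auto. intros j Hj HP. apply H. eauto.
Qed.

Definition eq_dec_classic {A : Type} (x y : A) : {x = y} + {x <> y} :=
  excluded_middle_informative (x = y).

Definition truth (P : Prop) : bool :=
  if excluded_middle_informative P then true else false.

Lemma truth_iff (P : Prop) : truth P = true <-> P.
Proof. unfold truth. destruct (excluded_middle_informative P); intuition congruence. Qed.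

(** * Counting up to a threshold *)

(** Branching may be infinite, so cardinalities are replaced by lower bounds witnessed by
    duplicate-free lists. *)
Definition at_least {I : Type} (n : nat) (P : I -> Prop) : Prop :=
  exists l : list I, NoDup l /\ length l = n /\ forall i, In i l -> P i.

Lemma NoDup_firstn {I : Type} (n : nat) (l : list I) : NoDup l -> NoDup (firstn n l).
Proof.
  intros H. rewrite <- (firstn_skipn n l) in H. apply NoDup_app_remove_r in H. exact H.
Qed.

Lemma In_firstn {I : Type} (n : nat) (l : list I) (i : I) : In i (firstn n l) -> In i l.
Proof. intros H. rewrite <- (firstn_skipn n l). apply in_or_app. now left. Qed.

Lemma at_least_prefix {I : Type} (n : nat) (P : I -> Prop) (l : list I) :
  NoDup l -> n <= length l -> (forall i, In i l -> P i) -> at_least n P.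
Proof.
  intros Hl Hn HP. exists (firstn n l). split; [now apply NoDup_firstn|]. split.
  - rewrite length_firstn. lia.
  - intros i Hi. apply HP. eapply In_firstn; eauto.
Qed.

Lemma at_least_antimono {I : Type} (n p : nat) (P : I -> Prop) :
  n <= p -> at_least p P -> at_least n P.
Proof. intros H [l [Hl [Hp HP]]]. apply (at_least_prefix n P l); auto. lia. Qed.

Lemma at_least_weaken {I : Type} (n : nat) (P Q : I -> Prop) :
  (forall i, P i -> Q i) -> at_least n P -> at_least n Q.
Proof. intros H [l [Hl [Hp HP]]]. exists l. auto. Qed.

Lemma at_least_0 {I : Type} (P : I -> Prop) : at_least 0 P.
Proof. exists []. split; [constructor|]. split; auto. intros i []. Qed.

Lemma at_least_1 {I : Type} (P : I -> Prop) : at_least 1 P <-> exists i, P i.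
Proof.
  split.
  - intros [[|i l] [_ [Hl HP]]]; simpl in Hl; [lia|]. exists i. apply HP. now left.
  - intros [i Hi]. exists [i]. split; [repeat constructor; auto|]. split; auto.
    intros j [<-|[]]. auto.
Qed.

Lemma at_least_2 {I : Type} (P : I -> Prop) :
  at_least 2 P <-> exists i j, i <> j /\ P i /\ P j.
Proof.
  split.
  - intros [[|i [|j l]] [Hd [Hl HP]]]; simpl in Hl; try lia.
    exists i, j. inversion Hd as [|? ? Hi _]; subst. split.
    + intros ->. apply Hi. now left.
    + split; apply HP; simpl; auto.
  - intros (i & j & Hij & Hi & Hj). exists [i; j]. split.
    + repeat constructor; simpl; intuition.
    + split; auto. intros k [<-|[<-|[]]]; auto.
Qed.

(** A failed lower bound makes the set finite: the longest list that succeeds is already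
    complete. *)
Lemma not_at_least_listing {I : Type} (n : nat) (P : I -> Prop) :
  ~ at_least n P ->
  exists l, NoDup l /\ length l < n /\ at_least (length l) P /\ forall i, P i <-> In i l.
Proof.
  induction n as [|n IH]; intros H.
  - destruct H. apply at_least_0.
  - destruct (classic (at_least n P)) as [[l [Hl [Hn HP]]]|Hn].
    + exists l. split; auto. split; [lia|]. split; [exists l; auto|].
      intros i. split; auto. intros Hi. apply NNPP. intros Hni. apply H.
      exists (i :: l). split; [constructor; auto|]. split; [simpl; lia|].
      intros j [<-|Hj]; auto.
    + destruct (IH Hn) as [l [H1 [H2 H3]]]. exists l. repeat (split; auto).
Qed.

Definition fibre {I S : Type} (f : I -> S) (s : S) (l : list I) : list I :=
  filter (fun i => truth (f i = s)) l.

Lemma In_fibre {I S : Type} (f : I -> S) (s : S) (l : list I) (i : I) :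
  In i (fibre f s l) <-> In i l /\ f i = s.
Proof. unfold fibre. now rewrite filter_In, truth_iff. Qed.

Lemma length_fibre {I S : Type} (f : I -> S) (s : S) (l : list I) :
  length (fibre f s l) = count_occ eq_dec_classic (map f l) s.
Proof.
  induction l as [|i l IH]; simpl; auto. unfold fibre in *. simpl.
  unfold truth at 1, eq_dec_classic at 1.
  destruct (excluded_middle_informative (f i = s)); simpl; auto.
Qed.

Lemma at_least_fibre {I S : Type} (f : I -> S) (s : S) (l : list I) (n : nat) :
  NoDup l ->
  (at_least n (fun i => In i l /\ f i = s) <->
   n <= count_occ eq_dec_classic (map f l) s).
Proof.
  intros Hl. rewrite <- length_fibre. split.
  - intros [l' [Hd [<- HP]]]. apply NoDup_incl_length; auto.
    intros i Hi. apply In_fibre. auto.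
  - intros Hn. apply (at_least_prefix n _ (fibre f s l)); auto.
    + apply NoDup_filter; auto.
    + intros i. apply In_fibre.
Qed.

Fixpoint count_upto {I : Type} (t : nat) (P : I -> Prop) : nat :=
  match t with
  | 0 => 0
  | S t' => if excluded_middle_informative (at_least (S t') P) then S t'
            else count_upto t' P
  end.

Lemma le_count_upto {I : Type} (t : nat) (P : I -> Prop) (n : nat) :
  n <= t -> (n <= count_upto t P <-> at_least n P).
Proof.
  induction t as [|t IH]; intros Hn; simpl.
  - replace n with 0 by lia. split; auto using at_least_0.
  - destruct (excluded_middle_informative (at_least (S t) P)) as [H|H].
    + split; auto. intros _. apply (at_least_antimono n (S t)); auto.
    + destruct (Nat.eq_dec n (S t)) as [->|Hne]; [|apply IH; lia].
      split; [|tauto]. intros Hc. exfalso.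
      enough (count_upto t P <= t) by lia. clear.
      induction t; simpl; auto. destruct (excluded_middle_informative _); lia.
Qed.

Lemma count_upto_le {I : Type} (t : nat) (P : I -> Prop) : count_upto t P <= t.
Proof. induction t; simpl; auto. destruct (excluded_middle_informative _); lia. Qed.

Lemma count_upto_eq {I J : Type} (t : nat) (P : I -> Prop) (Q : J -> Prop) :
  count_upto t P = count_upto t Q <->
  forall n, n <= t -> (at_least n P <-> at_least n Q).
Proof.
  split.
  - intros H n Hn. rewrite <- (le_count_upto t P), <- (le_count_upto t Q), H by auto. tauto.
  - intros H. pose proof (count_upto_le t P). pose proof (count_upto_le t Q).
    apply Nat.le_antisymm.
    + apply le_count_upto; auto. apply H; auto. apply (le_count_upto t P); auto.
    + apply le_count_upto; auto. apply H; auto. apply (le_count_upto t Q); auto.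
Qed.

(** Addition over classes without sums: the witnessing list is copied element by element, each copy
    having the class of its original, so that only counts inside one class are ever compared. *)
Lemma at_least_by_classes {I J T : Type} (g : I -> T) (g' : J -> T)
    (P : I -> Prop) (Q : J -> Prop) (t : nat) :
  (forall s n, n <= t -> at_least n (fun i => P i /\ g i = s) ->
                         at_least n (fun j => Q j /\ g' j = s)) ->
  forall n, n <= t -> at_least n P -> at_least n Q.
Proof.
  intros H n Hn [l [Hl [Hlen HP]]].
  enough (exists l', NoDup l' /\ (forall j, In j l' -> Q j) /\ map g' l' = map g l)
    as (l' & Hd & HQ & Hm).
  { exists l'. split; auto. split; auto.
    rewrite <- (length_map g' l'), Hm, length_map. auto. }
  assert (Hle : length l <= t) by lia. clear Hlen Hn n.
  induction l as [|x l IH].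
  - exists []. split; [constructor|]. split; auto. intros j [].
  - inversion Hl as [|? ? Hx Hl']; subst. simpl in Hle.
    destruct IH as (l' & Hd & HQ & Hm); auto; [|lia|]. { intros; apply HP; now right. }
    set (q := count_occ eq_dec_classic (map g l) (g x)).
    assert (Hq : q <= length l).
    { unfold q. rewrite <- length_fibre. apply filter_length_le. }
    destruct (H (g x) (S q)) as [l2 [Hd2 [Hlen2 H2]]]; [lia| |].
    { apply (at_least_weaken _ (fun i => In i (x :: l) /\ g i = g x)).
      { intros i [Hi Hg]. split; auto. }
      apply at_least_fibre; auto. simpl.
      unfold eq_dec_classic at 1. destruct (excluded_middle_informative _); [|tauto].
      fold q. lia. }
    (* The copied part [l'] holds exactly [q] elements of this class, so one of [S q] distinct ones
       is fresh. *)
    assert (Hnew : exists y, In y l2 /\ ~ In y l').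
    { apply NNPP. intros Hno.
      assert (S q <= q); [|lia]. rewrite <- Hlen2 at 1. unfold q.
      rewrite <- Hm, <- length_fibre. apply NoDup_incl_length; auto.
      intros y Hy. apply In_fibre. split; [|now apply H2].
      apply NNPP. intros Hny. apply Hno. eauto. }
    destruct Hnew as (y & Hy & Hny). exists (y :: l'). split; [constructor; auto|].
    split.
    + intros j [<-|Hj]; auto. apply H2; auto.
    + simpl. rewrite Hm. f_equal. apply H2; auto.
Qed.

(** * Finite cardinality bounds *)

Definition fin_le (A : Type) (n : nat) : Prop :=
  exists l : list A, length l <= n /\ forall a, In a l.

Lemma fin_le_prod (A B : Type) (n p : nat) :
  fin_le A n -> fin_le B p -> fin_le (A * B) (n * p).
Proof.
  intros [l [Hl HA]] [k [Hk HB]]. exists (list_prod l k). split.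
  - rewrite length_prod. now apply Nat.mul_le_mono.
  - intros [a b]. apply in_prod; auto.
Qed.

Lemma fin_le_bool : fin_le bool 2.
Proof. exists [true; false]. split; auto. intros []; simpl; auto. Qed.

Lemma length_flat_map_le {A B : Type} (f : A -> list B) (n : nat) (l : list A) :
  (forall a, length (f a) <= n) -> length (flat_map f l) <= length l * n.
Proof.
  intros H. induction l as [|a l IH]; simpl; auto.
  rewrite length_app. specialize (H a). lia.
Qed.

Lemma fin_le_sigT (A : Type) (B : A -> Type) (n p : nat) :
  fin_le A n -> (forall a, fin_le (B a) p) -> fin_le {a : A & B a} (n * p).
Proof.
  intros [l [Hl HA]] HB. apply dep_choice in HB. destruct HB as [k Hk].
  exists (flat_map (fun a => map (existT B a) (k a)) l). split.
  - etransitivity; [apply (length_flat_map_le _ p)|now apply Nat.mul_le_mono_r].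
    intros a. rewrite length_map. apply Hk.
  - intros [a b]. apply in_flat_map. exists a. split; auto. apply in_map. apply Hk.
Qed.

(** Functions are enumerated up to agreement on the listed points; one more point multiplies the
    count by [p]. Repetitions in the listing do no harm. *)
Lemma fin_le_fun (A B : Type) (n p : nat) :
  fin_le A n -> fin_le B p -> 1 <= p -> fin_le (A -> B) (p ^ n).
Proof.
  intros [l [Hl HA]] [k [Hk HB]] Hp.
  enough (exists L : list (A -> B), length L <= p ^ length l /\
            forall f, exists g, In g L /\ forall a, In a l -> g a = f a)
    as (L & HL & Hf).
  { exists L. split.
    - etransitivity; [exact HL|]. apply Nat.pow_le_mono_r; lia.
    - intros f. destruct (Hf f) as [g [Hg He]].
      replace f with g; auto. apply functional_extensionality. auto. }
  clear HA Hl. induction l as [|a l IH].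
  - destruct (classic (inhabited (A -> B))) as [[f0]|Hno].
    + exists [f0]. split; auto. intros f. exists f0. split; [now left|]. intros a [].
    + exists []. split; [simpl; lia|]. intros f. destruct Hno. constructor. exact f.
  - destruct IH as (L & HL & Hf).
    exists (map (fun gb => fun x => if excluded_middle_informative (x = a) then snd gb
                                    else fst gb x) (list_prod L k)).
    split.
    + rewrite length_map, length_prod. simpl. rewrite Nat.mul_comm.
      now apply Nat.mul_le_mono.
    + intros f. destruct (Hf f) as [g [Hg He]].
      eexists. split.
      * apply in_map. apply (in_prod L k g (f a)); auto.
      * intros x Hx. simpl. destruct (excluded_middle_informative (x = a)) as [->|Hne]; auto.
        apply He. destruct Hx; [congruence|auto].
Qed.

Definition upto (t : nat) : Type := {n : nat | n <= t}.

Definition clip (t n : nat) : upto t := exist _ (Nat.min n t) (Nat.le_min_r n t).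

Lemma clip_surj (t : nat) (x : upto t) : clip t (proj1_sig x) = x.
Proof.
  destruct x as [n Hn]. unfold clip. simpl. apply subset_eq_compat. lia.
Qed.

Lemma clip_inj (t a b : nat) : a <= t -> b <= t -> clip t a = clip t b -> a = b.
Proof. intros Ha Hb H. apply (f_equal (@proj1_sig _ _)) in H. simpl in H. lia. Qed.

Lemma fin_le_upto (t : nat) : fin_le (upto t) (S t).
Proof.
  exists (map (clip t) (seq 0 (S t))). split.
  - now rewrite length_map, length_seq.
  - intros x. rewrite <- (clip_surj t x). apply in_map. apply in_seq.
    destruct x; simpl; lia.
Qed.

(** * Redistributing components *)

(** A finite sample that shows every fibre count up to [t]: [t] elements of each large fibre,
    everything from each small one. It controls the surplus in a set move and also selects the
    components that survive pruning. *)
Lemma fibre_sample {I S : Type} (A : I -> Prop) (f : I -> S) (t : nat) (k : list S) :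
  exists L, NoDup L /\ (forall i, In i L -> A i /\ In (f i) k) /\
    length L <= t * length k /\
    forall s, In s k -> at_least t (fun i => In i L /\ f i = s) \/
                        (forall i, A i -> f i = s -> In i L).
Proof.
  induction k as [|s k IH].
  - exists []. split; [constructor|]. split; [intros i []|]. split; [simpl; lia|].
    intros s [].
  - destruct IH as (L & Hd & HA & Hlen & Hs).
    destruct (classic (In s k)) as [Hin|Hnin].
    { exists L. split; auto. split; [intros i Hi; destruct (HA i Hi); simpl; auto|].
      split; [simpl; lia|]. intros s' [<-|Hs']; auto. }
    assert (Hl : exists l, NoDup l /\ (forall i, In i l -> A i /\ f i = s) /\
       length l <= t /\ (t <= length l \/ forall i, A i -> f i = s -> In i l)).
    { destruct (classic (at_least t (fun i => A i /\ f i = s))) as [[l [H1 [H2 H3]]]|H].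
      - exists l. split; auto. split; auto. split; [lia|]. left; lia.
      - apply not_at_least_listing in H. destruct H as (l & H1 & H2 & _ & H3).
        exists l. split; auto. split; [intros i Hi; now apply H3|]. split; [lia|].
        right. intros i Hi Hf. apply H3. auto. }
    destruct Hl as (l & Hdl & Hl & Hlt & Hor).
    exists (l ++ L). split.
    { apply NoDup_app; auto. intros i Hi HiL. apply Hnin.
      destruct (Hl i Hi) as [_ <-]. now apply HA. }
    split.
    { intros i Hi. apply in_app_or in Hi. destruct Hi as [Hi|Hi].
      - destruct (Hl i Hi) as [? <-]. simpl; auto.
      - destruct (HA i Hi). simpl; auto. }
    split; [rewrite length_app; simpl; lia|].
    intros s' [<-|Hs'].
    + destruct Hor as [Hor|Hor].
      * left. apply (at_least_prefix t _ l); auto. intros i Hi. split.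
        -- apply in_or_app; auto.
        -- now apply Hl.
      * right. intros i Hi Hf. apply in_or_app. left; auto.
    + destruct (Hs s' Hs') as [H|H].
      * left. revert H. apply at_least_weaken. intros i [Hi Hf].
        split; auto. apply in_or_app; auto.
      * right. intros i Hi Hf. apply in_or_app. auto.
Qed.

Lemma list_transfer {I J S : Type} (f : I -> S) (g0 : J -> S) (L : list I) (L' : list J) :
  length L = length L' -> NoDup L' ->
  exists f', map f' L' = map f L /\ forall j, ~ In j L' -> f' j = g0 j.
Proof.
  revert L. induction L' as [|j L' IH]; intros [|i L] Hlen Hd; simpl in Hlen; try lia.
  - exists g0. auto.
  - inversion Hd as [|? ? Hj Hd']; subst.
    destruct (IH L) as (f' & Hm & Hf); auto.
    exists (fun x => if excluded_middle_informative (x = j) then f i else f' x). split.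
    + simpl. destruct (excluded_middle_informative (j = j)); [|tauto]. f_equal.
      rewrite <- Hm. apply map_ext_in. intros x Hx.
      destruct (excluded_middle_informative (x = j)) as [->|]; tauto.
    + intros x Hx. destruct (excluded_middle_informative (x = j)) as [->|].
      * destruct Hx. now left.
      * apply Hf. intros H. apply Hx. now right.
Qed.

Lemma at_least_transfer {I J S : Type} (f : I -> S) (f' : J -> S) (L : list I) (L' : list J)
    (s : S) (n : nat) :
  NoDup L -> NoDup L' -> map f' L' = map f L ->
  (at_least n (fun i => In i L /\ f i = s) <-> at_least n (fun j => In j L' /\ f' j = s)).
Proof. intros H H' Hm. rewrite !at_least_fibre by auto. rewrite Hm. tauto. Qed.

(* If [A] is large, some fibre of [f] on [A] has at least [t] elements, and that
   fibre absorbs all surplus elements of [B]. *)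
Lemma redistribute {I J S : Type} (A : I -> Prop) (B : J -> Prop) (f : I -> S) (g0 : J -> S)
    (s t T : nat) :
  fin_le S s -> 1 <= t -> t * s < T ->
  (forall n, n <= T -> (at_least n A <-> at_least n B)) ->
  exists f' : J -> S,
    (forall j, B j -> exists i, A i /\ f' j = f i) /\
    forall x n, n <= t -> (at_least n (fun i => A i /\ f i = x) <->
                           at_least n (fun j => B j /\ f' j = x)).
Proof.
  intros [k [Hk Hall]] Ht HT Heq.
  destruct (classic (at_least T A)) as [Hbig|Hsmall].
  - destruct (fibre_sample A f t k) as (L & Hd & HA & Hlen & Hs).
    assert (HLT : length L < T) by nia.
    (* If no fibre reached [t] in the sample, the sample would contain every listed element of [A];
       but it is shorter than [T]. *)
    assert (Hex : exists s0, at_least t (fun i => In i L /\ f i = s0)).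
    { apply NNPP. intros Hno. destruct Hbig as [l [Hdl [Hll HlA]]].
      assert (length l <= length L); [|lia].
      apply NoDup_incl_length; auto. intros i Hi.
      destruct (Hs (f i) (Hall _)) as [H|H]; [|auto]. destruct Hno. eauto. }
    destruct Hex as [s0 Hs0].
    assert (HB : at_least (length L) B).
    { apply Heq; [lia|]. apply (at_least_antimono _ T); auto. lia. }
    destruct HB as (L' & Hd' & Hlen' & HB).
    destruct (list_transfer f (fun _ => s0) L L') as (f' & Hm & Hf'); auto.
    exists f'. split.
    + intros j Hj. destruct (classic (In j L')) as [Hin|Hnin].
      * apply (in_map f') in Hin. rewrite Hm in Hin. apply in_map_iff in Hin.
        destruct Hin as (i & Hi & HiL). exists i. split; auto. now apply HA.
      * rewrite Hf' by auto. apply (at_least_antimono 1) in Hs0; auto.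
        destruct (proj1 (at_least_1 _) Hs0) as (i & HiL & Hi). exists i.
        split; auto. now apply HA.
    + intros x n Hn.
      pose proof (at_least_transfer f f' L L' x n Hd Hd' Hm) as Htr.
      destruct (classic (x = s0)) as [->|Hx].
      * assert (Hn0 : at_least n (fun i => In i L /\ f i = s0))
          by (apply (at_least_antimono n t); auto).
        split; intros _.
        -- apply Htr in Hn0. revert Hn0. apply at_least_weaken. intros j [Hj ?]; auto.
        -- revert Hn0. apply at_least_weaken. intros i [Hi ?]. split; auto. now apply HA.
      * split; intros H.
        -- assert (H' : at_least n (fun i => In i L /\ f i = x)).
           { destruct (Hs x (Hall x)) as [H'|H'].
             - apply (at_least_antimono n t); auto.
             - revert H. apply at_least_weaken. intros i [? ?]; auto. }
           apply Htr in H'. revert H'. apply at_least_weaken. intros j [Hj ?]; auto.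
        -- assert (H' : at_least n (fun j => In j L' /\ f' j = x)).
           { revert H. apply at_least_weaken. intros j [Hj Hfj]. split; auto.
             apply NNPP. intros Hnin. apply Hf' in Hnin. congruence. }
           apply Htr in H'. revert H'. apply at_least_weaken.
           intros i [Hi ?]. split; auto. now apply HA.
  (* Neither set reaches [T], so both are finite and of equal size, and [f] can be copied along a
     matching of their listings. *)
  - assert (Hsmall' : ~ at_least T B) by (intros H; apply Hsmall, Heq; auto).
    apply not_at_least_listing in Hsmall. destruct Hsmall as (L & Hd & HlL & HaL & HA).
    apply not_at_least_listing in Hsmall'. destruct Hsmall' as (L' & Hd' & HlL' & HaL' & HB).
    assert (Hlen : length L = length L').
    { apply Heq in HaL; [|lia]. apply Heq in HaL'; [|lia].
      destruct HaL as (l1 & Hd1 & Hl1 & H1). destruct HaL' as (l2 & Hd2 & Hl2 & H2).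
      apply Nat.le_antisymm.
      - rewrite <- Hl1. apply NoDup_incl_length; auto. intros j Hj. apply HB; auto.
      - rewrite <- Hl2. apply NoDup_incl_length; auto. intros j Hj. apply HA; auto. }
    destruct (list_transfer f g0 L L') as (f' & Hm & Hf'); auto.
    exists f'. split.
    + intros j Hj. apply HB in Hj. apply (in_map f') in Hj. rewrite Hm in Hj.
      apply in_map_iff in Hj. destruct Hj as (i & Hi & HiL). exists i.
      split; auto. now apply HA.
    + intros x n Hn. pose proof (at_least_transfer f f' L L' x n Hd Hd' Hm) as Htr.
      split; intros H.
      * assert (H' : at_least n (fun i => In i L /\ f i = x))
          by (revert H; apply at_least_weaken; intros i [Hi ?]; split; auto; now apply HA).
        apply Htr in H'. revert H'. apply at_least_weaken. intros j [Hj ?].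
        split; auto. now apply HB.
      * assert (H' : at_least n (fun j => In j L' /\ f' j = x))
          by (revert H; apply at_least_weaken; intros i [Hi ?]; split; auto; now apply HB).
        apply Htr in H'. revert H'. apply at_least_weaken. intros j [Hj ?].
        split; auto. now apply HA.
Qed.

(** * Trees of uniform height and their truncated counting types *)

Fixpoint htree (k : nat) : Type :=
  match k with
  | 0 => unit
  | S k' => {I : Type & I -> htree k'}
  end.

Fixpoint leaves (k : nat) : htree k -> Type :=
  match k return htree k -> Type with
  | 0 => fun _ => unit
  | S k' => fun t => {i : projT1 t & leaves k' (projT2 t i)}
  end.

Definition below {k : nat} {C : Type} (t : htree (S k)) (c : leaves (S k) t -> C)
    (i : projT1 t) : leaves k (projT2 t i) -> C :=
  fun x => c (existT _ i x).

(* [height_meet k t x y l]: the lowest common ancestor of [x] and [y] has height [l]. *)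
Fixpoint height_meet (k : nat) : forall t : htree k, leaves k t -> leaves k t -> nat -> Prop :=
  match k return forall t : htree k, leaves k t -> leaves k t -> nat -> Prop with
  | 0 => fun _ _ _ l => l = 0
  | S k' => fun t x y l =>
      (exists i a b, x = existT _ i a /\ y = existT _ i b /\
                     height_meet k' (projT2 t i) a b l) \/
      (projT1 x <> projT1 y /\ l = S k')
  end.

(* The threshold with [m] rounds to go and [n] colours, when components have [N m n]
   types; a round doubles the number of colours. *)
Fixpoint threshold_of (N : nat -> nat -> nat) (m n : nat) : nat :=
  match m with
  | 0 => 2
  | S m' => S (threshold_of N m' (2 * n) * N m' (2 * n))
  end.

Fixpoint num_types (k m n : nat) : nat :=
  match k with
  | 0 => n
  | S k' => S (threshold_of (num_types k') m n) ^ num_types k' m n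
  end.

Definition threshold (k : nat) : nat -> nat -> nat := threshold_of (num_types k).

Fixpoint ttype (k m n : nat) (C : Type) : Type :=
  match k with
  | 0 => C
  | S k' => ttype k' m n C -> upto (threshold k' m n)
  end.

Fixpoint type_of (k m n : nat) (C : Type) :
    forall t : htree k, (leaves k t -> C) -> ttype k m n C :=
  match k return forall t : htree k, (leaves k t -> C) -> ttype k m n C with
  | 0 => fun t c => c tt
  | S k' => fun t c => fun s =>
      clip (threshold k' m n)
        (count_upto (threshold k' m n)
           (fun i => type_of k' m n C (projT2 t i) (below t c i) = s))
  end.

Lemma threshold_ge_1 (k m n : nat) : 1 <= threshold k m n.
Proof. unfold threshold. destruct m; simpl; lia. Qed.


Lemma fin_le_ttype (k m n : nat) (C : Type) :
  fin_le C n -> fin_le (ttype k m n C) (num_types k m n).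
Proof.
  intros HC. induction k as [|k IH]; simpl; auto.
  apply fin_le_fun; auto; [|lia]. apply fin_le_upto.
Qed.

Lemma type_of_eq_S (k m n : nat) (C : Type) (t t' : htree (S k))
    (c : leaves (S k) t -> C) (c' : leaves (S k) t' -> C) :
  type_of (S k) m n C t c = type_of (S k) m n C t' c' <->
  forall s p, p <= threshold k m n ->
    (at_least p (fun i => type_of k m n C (projT2 t i) (below t c i) = s) <->
     at_least p (fun i => type_of k m n C (projT2 t' i) (below t' c' i) = s)).
Proof.
  split.
  - intros H s. apply count_upto_eq. apply (f_equal (fun F => F s)) in H. simpl in H.
    apply clip_inj in H; auto using count_upto_le.
  - intros H. simpl. apply functional_extensionality. intros s.
    f_equal. apply count_upto_eq. auto.
Qed.

(** * What a type reveals about colours and meeting heights *)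

Lemma matching_component (k m n : nat) (C : Type) (t t' : htree (S k))
    (c : leaves (S k) t -> C) (c' : leaves (S k) t' -> C) (i : projT1 t) :
  type_of (S k) m n C t c = type_of (S k) m n C t' c' ->
  exists i', type_of k m n C (projT2 t i) (below t c i) =
             type_of k m n C (projT2 t' i') (below t' c' i').
Proof.
  intros H. rewrite type_of_eq_S in H.
  destruct (proj1 (H (type_of k m n C (projT2 t i) (below t c i)) 1 (threshold_ge_1 _ _ _)))
    as (l & _ & Hl & Hi).
  - apply at_least_1. eauto.
  - destruct l as [|i' l]; [simpl in Hl; lia|]. exists i'. symmetry. apply Hi. now left.
Qed.

(** A threshold of at least 1 gives every component a partner of its own type, and the search
    descends to a leaf. This transfers nonemptiness of any union of colour classes. *)
Lemma type_of_exists (k m n : nat) (C : Type) (t t' : htree k)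
    (c : leaves k t -> C) (c' : leaves k t' -> C) (P : C -> Prop) :
  type_of k m n C t c = type_of k m n C t' c' ->
  (exists x, P (c x)) -> exists x', P (c' x').
Proof.
  revert t t' c c'. induction k as [|k IH]; intros t t' c c' H [x Hx].
  - exists tt. simpl in H. destruct x. congruence.
  - destruct x as [i a]. destruct (matching_component k m n C t t' c c' i H) as [i' Hi].
    destruct (IH _ _ _ _ Hi) as [a' Ha]; [exists a; exact Hx|].
    exists (existT _ i' a'). exact Ha.
Qed.

Lemma num_types_pos (k m n : nat) : 1 <= n -> 1 <= num_types k m n.
Proof.
  intros Hn. destruct k; simpl; auto.
  apply Nat.neq_0_lt_0, Nat.pow_nonzero. lia.
Qed.

Lemma threshold_ge_2 (k m n : nat) : 1 <= n -> 2 <= threshold k m n.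
Proof.
  intros Hn. unfold threshold. revert n Hn. induction m as [|m IH]; intros n Hn.
  - simpl. lia.
  - simpl. assert (1 <= num_types k m (n + (n + 0))) by (apply num_types_pos; lia).
    assert (2 <= threshold_of (num_types k) m (n + (n + 0))) by (apply IH; lia).
    nia.
Qed.

(** This is why the thresholds start at 2: singletons have to be recognised. Two leaves may share a
    component, lie in components of different types, or lie in two components of one type; only the
    last case uses the count 2. *)
Lemma type_of_two (k m n : nat) (C : Type) (t t' : htree k)
    (c : leaves k t -> C) (c' : leaves k t' -> C) (P : C -> Prop) :
  1 <= n -> type_of k m n C t c = type_of k m n C t' c' ->
  (exists x y, x <> y /\ P (c x) /\ P (c y)) ->
  exists x y, x <> y /\ P (c' x) /\ P (c' y).
Proof.
  intros Hn. revert t t' c c'.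
  induction k as [|k IH]; intros t t' c c' H (x & y & Hxy & Hx & Hy).
  - destruct x, y. tauto.
  - destruct x as [i a], y as [j b].
    destruct (classic (i = j)) as [<-|Hij].
    + destruct (matching_component k m n C t t' c c' i H) as [i' Hi].
      destruct (IH _ _ _ _ Hi) as (a' & b' & Hab & Ha & Hb).
      { exists a, b. repeat split; auto. congruence. }
      exists (existT _ i' a'), (existT _ i' b'). repeat split; auto.
      intros E. apply Hab. apply inj_pair2 in E. exact E.
    + enough (exists i' j', i' <> j' /\
         type_of k m n C (projT2 t i) (below t c i) =
         type_of k m n C (projT2 t' i') (below t' c' i') /\
         type_of k m n C (projT2 t j) (below t c j) =
         type_of k m n C (projT2 t' j') (below t' c' j')) as (i' & j' & Hij' & Hi & Hj).
      { destruct (type_of_exists _ _ _ _ _ _ _ _ P Hi) as [a' Ha]; [exists a; exact Hx|].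
        destruct (type_of_exists _ _ _ _ _ _ _ _ P Hj) as [b' Hb]; [exists b; exact Hy|].
        exists (existT _ i' a'), (existT _ j' b'). repeat split; auto.
        intros E. apply Hij'. exact (f_equal (@projT1 _ _) E). }
      destruct (classic (type_of k m n C (projT2 t i) (below t c i) =
                         type_of k m n C (projT2 t j) (below t c j))) as [E|E].
      * rewrite type_of_eq_S in H.
        destruct (proj1 (at_least_2 _) (proj1 (H (type_of k m n C (projT2 t i) (below t c i)) 2
           (threshold_ge_2 _ _ _ Hn)) (proj2 (at_least_2 _)
             (ex_intro _ i (ex_intro _ j (conj Hij (conj eq_refl (eq_sym E)))))))) as
          (i' & j' & Hij' & Hi & Hj).
        exists i', j'. repeat split; auto. congruence.
      * destruct (matching_component k m n C t t' c c' i H) as [i' Hi].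
        destruct (matching_component k m n C t t' c c' j H) as [j' Hj].
        exists i', j'. repeat split; auto. intros ->. congruence.
Qed.

Lemma height_meet_total (k : nat) (t : htree k) (x y : leaves k t) :
  exists l, height_meet k t x y l.
Proof.
  induction k as [|k IH]; simpl; eauto.
  destruct x as [i a], y as [j b]. destruct (classic (i = j)) as [<-|Hij].
  - destruct (IH _ a b) as [l Hl]. exists l. left. exists i, a, b. auto.
  - exists (S k). right. auto.
Qed.

Lemma height_meet_0 (k : nat) (t : htree k) (x y : leaves k t) :
  height_meet k t x y 0 -> x = y.
Proof.
  induction k as [|k IH]; simpl.
  - destruct x, y. auto.
  - intros [(i & a & b & -> & -> & H)|[_ H]]; [|lia]. now rewrite (IH _ _ _ H).
Qed.

Lemma height_meet_refl (k : nat) (t : htree k) (x : leaves k t) : height_meet k t x x 0.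
Proof.
  induction k as [|k IH]; simpl; auto. destruct x as [i a]. left. exists i, a, a. auto.
Qed.

(** [P] and [Q] name one leaf each on either side. If [x] and [y] share a component, any component
    of the same type on the other side contains a [P]-leaf and a [Q]-leaf, which can only be [x']
    and [y']. *)
Lemma type_of_height_meet (k m n : nat) (C : Type) (t t' : htree k)
    (c : leaves k t -> C) (c' : leaves k t' -> C) (P Q : C -> Prop)
    (x y : leaves k t) (x' y' : leaves k t') (l : nat) :
  type_of k m n C t c = type_of k m n C t' c' ->
  (forall z, P (c z) <-> z = x) -> (forall z, Q (c z) <-> z = y) ->
  (forall z, P (c' z) <-> z = x') -> (forall z, Q (c' z) <-> z = y') ->
  height_meet k t x y l -> height_meet k t' x' y' l.
Proof.
  revert t t' c c' x y x' y'.
  induction k as [|k IH]; intros t t' c c' x y x' y' H Hx Hy Hx' Hy' Hl; [exact Hl|].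
  assert (Hcomp : forall (t t' : htree (S k)) c c' (x y : leaves (S k) t)
                         (x' y' : leaves (S k) t') i,
    type_of (S k) m n C t c = type_of (S k) m n C t' c' ->
    P (c x) -> Q (c y) ->
    (forall z, P (c' z) -> z = x') -> (forall z, Q (c' z) -> z = y') ->
    projT1 x = i -> projT1 y = i ->
    exists i', type_of k m n C (projT2 t i) (below t c i) =
               type_of k m n C (projT2 t' i') (below t' c' i') /\
               (exists a', x' = existT _ i' a') /\ (exists b', y' = existT _ i' b')).
  { clear. intros t t' c c' x y x' y' i H Hx Hy Hx' Hy' Hxi Hyi.
    destruct x as [i0 a], y as [j0 b]. simpl in Hxi, Hyi. subst i0 j0.
    destruct (matching_component k m n C t t' c c' i H) as [i' Hi].
    destruct (type_of_exists _ _ _ _ _ _ _ _ P Hi) as [a' Ha]; [exists a; exact Hx|].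
    destruct (type_of_exists _ _ _ _ _ _ _ _ Q Hi) as [b' Hb]; [exists b; exact Hy|].
    exists i'. split; auto. split.
    - exists a'. symmetry. apply Hx'. exact Ha.
    - exists b'. symmetry. apply Hy'. exact Hb. }
  simpl in Hl |- *. destruct Hl as [(i & a & b & -> & -> & Hl)|[Hne ->]].
  - destruct (Hcomp t t' c c' (existT _ i a) (existT _ i b) x' y' i) as
      (i' & Hi & [a' ->] & [b' ->]); auto.
    + now apply Hx.
    + now apply Hy.
    + intros z; apply Hx'.
    + intros z; apply Hy'.
    + left. exists i', a', b'. split; auto. split; auto.
      apply (IH _ _ _ _ a b a' b' Hi); auto.
      * intros z. unfold below. rewrite Hx. split; [apply inj_pair2|now intros ->].
      * intros z. unfold below. rewrite Hy. split; [apply inj_pair2|now intros ->].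
      * intros z. unfold below. rewrite Hx'. split; [apply inj_pair2|now intros ->].
      * intros z. unfold below. rewrite Hy'. split; [apply inj_pair2|now intros ->].
  (* Were [x'] and [y'] in one component, the same argument with the trees exchanged would put [x]
     and [y] into one. *)
  - right. split; auto. intros E. apply Hne.
    destruct (Hcomp t' t c' c x' y' x y (projT1 x')) as (i' & _ & [a ->] & [b ->]); auto.
    + now apply Hx'.
    + now apply Hy'.
    + intros z; apply Hx.
    + intros z; apply Hy.
Qed.

(* The duplicator's answer to a set move. *)
Lemma type_of_extend (k m n : nat) (C : Type) (t t' : htree k)
    (c : leaves k t -> C) (c' : leaves k t' -> C) (X : leaves k t -> bool) :
  fin_le C n ->
  type_of k (S m) n C t c = type_of k (S m) n C t' c' ->
  exists X' : leaves k t' -> bool,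
    type_of k m (2 * n) (C * bool) t (fun x => (c x, X x)) =
    type_of k m (2 * n) (C * bool) t' (fun x => (c' x, X' x)).
Proof.
  intros HC. revert t t' c c' X.
  induction k as [|k IH]; intros t t' c c' X H.
  - exists (fun _ => X tt). simpl in *. congruence.
  - rewrite type_of_eq_S in H.
    set (f := fun i => type_of k m (2 * n) (C * bool) (projT2 t i)
                         (below t (fun x => (c x, X x)) i)).
    (* Only a default for [redistribute]; the value [true] is arbitrary. *)
    set (g0 := fun i => type_of k m (2 * n) (C * bool) (projT2 t' i)
                          (below t' (fun x => (c' x, true)) i)).
    set (g := fun i => type_of k (S m) n C (projT2 t i) (below t c i)).
    set (g' := fun i => type_of k (S m) n C (projT2 t' i) (below t' c' i)).
    assert (HC2 : fin_le (C * bool) (2 * n)).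
    { rewrite Nat.mul_comm. apply fin_le_prod; auto using fin_le_bool. }
    (* One redistribution for each old type, among the components of that type. The room it needs,
       more than the new threshold times the number of refined types, is exactly the recursion of
       [threshold_of]. *)
    assert (Hred : forall s, exists f' : projT1 t' -> ttype k m (2 * n) (C * bool),
       (forall j, g' j = s -> exists i, g i = s /\ f' j = f i) /\
       forall x p, p <= threshold k m (2 * n) ->
         (at_least p (fun i => g i = s /\ f i = x) <->
          at_least p (fun j => g' j = s /\ f' j = x))).
    { intros s. apply (redistribute _ _ f g0 (num_types k m (2 * n)) _ (threshold k (S m) n)).
      - apply fin_le_ttype; auto.
      - apply threshold_ge_1.
      - unfold threshold. simpl. lia.
      - apply H. }
    apply dep_choice in Hred. destruct Hred as [F HF].
    (* The type assigned to [j] is the refined type of a component with the same old type, so the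
       induction hypothesis realises it by a set on component [j]. *)
    assert (HX : forall j, exists Y : leaves k (projT2 t' j) -> bool,
       type_of k m (2 * n) (C * bool) (projT2 t' j) (fun x => (below t' c' j x, Y x))
       = F (g' j) j).
    { intros j. destruct (proj1 (HF (g' j)) j eq_refl) as (i & Hgi & Hfi).
      destruct (IH _ _ _ _ (below t X i) Hgi) as [Y HY]. exists Y.
      rewrite Hfi. symmetry. exact HY. }
    apply dep_choice in HX. destruct HX as [Y HY].
    exists (fun x => Y (projT1 x) (projT2 x)). apply type_of_eq_S.
    intros s p Hp.
    assert (Hbelow : forall j, type_of k m (2 * n) (C * bool) (projT2 t' j)
       (below t' (fun x => (c' x, Y (projT1 x) (projT2 x))) j) = F (g' j) j).
    { intros j. apply HY. }
    (* Within each old type the counts agree by [HF]; [at_least_by_classes] adds up over the old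
       types. *)
    split; intros Hal.
    + revert p Hp Hal. apply (at_least_by_classes g g'). intros u p Hp Hal.
      assert (H' : at_least p (fun i => g i = u /\ f i = s))
        by (revert Hal; apply at_least_weaken; intros i [? ?]; split; auto).
      apply (proj2 (HF u)) in H'; auto. revert H'. apply at_least_weaken.
      intros j [<- Hj]. rewrite Hbelow. auto.
    + revert p Hp Hal. apply (at_least_by_classes g' g). intros u p Hp Hal.
      assert (H' : at_least p (fun j => g' j = u /\ F u j = s)).
      { revert Hal. apply at_least_weaken. intros j [Hj <-]. rewrite Hbelow in Hj. auto. }
      apply (proj2 (HF u)) in H'; auto. revert H'. apply at_least_weaken.
      intros i [? ?]; split; auto.
Qed.

(** * Pruning a tree to bounded size *)

Fixpoint small_size (k m n : nat) : nat :=
  match k with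
  | 0 => 1
  | S k' => num_types k' m n * threshold k' m n * small_size k' m n
  end.

Lemma list_lift {I : Type} (Q : I -> Prop) (l : list I) :
  (forall i, In i l -> Q i) -> exists l' : list {i | Q i}, map (@proj1_sig _ _) l' = l.
Proof.
  induction l as [|i l IH]; intros H.
  - exists []. auto.
  - destruct IH as [l' Hl']; [intros j Hj; apply H; now right|].
    exists (exist _ i (H i (or_introl eq_refl)) :: l'). simpl. now rewrite Hl'.
Qed.

(** The embedding [e] keeps meeting heights, so an adjacency rule for [t] restricts to [t']; this
    makes the pruned graph playable against the original one. *)
Lemma small_subtree (k m n : nat) (C : Type) (t : htree k) (c : leaves k t -> C) :
  fin_le C n ->
  exists (t' : htree k) (e : leaves k t' -> leaves k t),
    fin_le (leaves k t') (small_size k m n) /\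
    (forall x y l, height_meet k t' x y l <-> height_meet k t (e x) (e y) l) /\
    type_of k m n C t' (fun x => c (e x)) = type_of k m n C t c.
Proof.
  intros HC. revert t c. induction k as [|k IH]; intros t c.
  - exists tt, (fun x => x). split; [exists [tt]; split; auto; intros []; now left|].
    split; simpl; auto. tauto.
  - set (g := fun i => type_of k m n C (projT2 t i) (below t c i)).
    destruct (fin_le_ttype k m n C HC) as [ks [Hks Hall]].
    set (T := threshold k m n).
    destruct (fibre_sample (fun _ => True) g T ks) as (L & Hd & _ & Hlen & Hs).
    set (J := {i : projT1 t | In i L}).
    assert (HJ : fin_le J (num_types k m n * T)).
    { assert (HJ : exists l : list J, map (@proj1_sig _ _) l = L).
      { apply list_lift. auto. }
      destruct HJ as [l Hl]. exists l. split.
      - assert (E : length l = length L) by (rewrite <- Hl, length_map; auto).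
        change (length l <= num_types k m n * T). nia.
      - intros [i Hi]. assert (Hi' := Hi). rewrite <- Hl in Hi'.
        apply in_map_iff in Hi'. destruct Hi' as ([j Hj] & Hij & Hin).
        simpl in Hij. subst j. rewrite (proof_irrelevance _ Hi Hj). auto. }
    assert (Hsub : forall j : J, exists te : {t' : htree k & leaves k t' ->
                                    leaves k (projT2 t (proj1_sig j))},
       fin_le (leaves k (projT1 te)) (small_size k m n) /\
       (forall x y l, height_meet k (projT1 te) x y l <->
          height_meet k (projT2 t (proj1_sig j)) (projT2 te x) (projT2 te y) l) /\
       type_of k m n C (projT1 te) (fun x => below t c (proj1_sig j) (projT2 te x)) =
       g (proj1_sig j)).
    { intros j. destruct (IH (projT2 t (proj1_sig j)) (below t c (proj1_sig j)))
        as (t' & e & H). exists (existT _ t' e). exact H. }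
    apply dep_choice in Hsub. destruct Hsub as [te Hte].
    set (t' := existT (fun I => I -> htree k) J (fun j => projT1 (te j)) : htree (S k)).
    set (e := fun x : leaves (S k) t' =>
       existT (fun i => leaves k (projT2 t i)) (proj1_sig (projT1 x))
              (projT2 (te (projT1 x)) (projT2 x)) : leaves (S k) t).
    exists t', e. split; [|split].
    + simpl. apply fin_le_sigT; auto. intros j. apply Hte.
    + intros x y l. destruct x as [j a], y as [j' b].
      simpl. split.
      * intros [(i & a0 & b0 & E1 & E2 & H)|[Hne ->]].
        -- left.
           pose proof (f_equal (@projT1 _ _) E1) as Ej.
           pose proof (f_equal (@projT1 _ _) E2) as Ej'. simpl in Ej, Ej'.
           subst j j'. apply inj_pair2 in E1, E2. subst a0 b0.
           eexists _, _, _. split; [reflexivity|]. split; [reflexivity|].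
           simpl. now apply Hte.
        -- right. split; auto. intros E. apply Hne. destruct j as [j Hj], j' as [j' Hj'].
           simpl in E. subst j'. f_equal. apply proof_irrelevance.
      * intros [(i & a0 & b0 & E1 & E2 & H)|[Hne ->]].
        -- left.
           pose proof (f_equal (@projT1 _ _) E1) as Ej.
           pose proof (f_equal (@projT1 _ _) E2) as Ej'. unfold e in Ej, Ej'. simpl in Ej, Ej'.
           assert (j = j') by (destruct j as [j Hj], j' as [j' Hj']; simpl in *; subst;
                               f_equal; apply proof_irrelevance).
           subst j'. subst i. unfold e in E1, E2. simpl in E1, E2.
           apply inj_pair2 in E1, E2. subst a0 b0.
           exists j, a, b. split; auto. split; auto. now apply Hte.
        -- right. split; auto. intros E. apply Hne. simpl in E. unfold e. simpl. now subst.
    + apply type_of_eq_S. intros s p Hp.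
      assert (Hbel : forall j : J, type_of k m n C (projT2 t' j)
                (below t' (fun x => c (e x)) j) = g (proj1_sig j)).
      { intros j. destruct (Hte j) as (_ & _ & H). exact H. }
      split; intros Hal.
      * destruct Hal as (l & Hdl & Hll & Hl). exists (map (@proj1_sig _ _) l).
        split; [|split].
        -- apply NoDup_map_NoDup_ForallPairs; auto. intros [a Ha] [b Hb] _ _ E.
           simpl in E. subst. f_equal. apply proof_irrelevance.
        -- now rewrite length_map.
        -- intros i Hi. apply in_map_iff in Hi. destruct Hi as (j & <- & Hj).
           apply Hl in Hj. rewrite Hbel in Hj. exact Hj.
      (* Either the sample kept [T] components of this type, enough for [p], or it kept all of
         them. *)
      * assert (Hal' : at_least p (fun i => In i L /\ g i = s)).
        { destruct (Hs s (Hall s)) as [H|H].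
          - apply (at_least_antimono p T); auto.
          - revert Hal. apply at_least_weaken. intros i Hi. split; auto. }
        destruct Hal' as (l & Hdl & Hll & Hl).
        assert (Hlift : exists l' : list J, map (@proj1_sig _ _) l' = l).
        { apply list_lift. intros i Hi. now apply Hl. }
        destruct Hlift as [l' <-]. exists l'. split; [|split].
        -- eapply NoDup_map_inv; eauto.
        -- now rewrite length_map in Hll.
        -- intros j Hj. rewrite Hbel. apply Hl. now apply in_map.
Qed.

(** * Back-and-forth systems *)

(** [Z m] relates positions with [m] rounds left. Isomorphisms and the tree game are both instances,
    so the induction on formulas is done once. *)
Record back_and_forth (G G' : graph)
    (Z : nat -> (nat -> option (gV G)) -> (nat -> gV G -> Prop) ->
         (nat -> option (gV G')) -> (nat -> gV G' -> Prop) -> Prop) : Prop := {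
  bf_edge m e1 e2 e1' e2' x y : Z m e1 e2 e1' e2' ->
    (sat G e1 e2 (MEdge x y) <-> sat G' e1' e2' (MEdge x y));
  bf_eq m e1 e2 e1' e2' x y : Z m e1 e2 e1' e2' ->
    (sat G e1 e2 (MEq x y) <-> sat G' e1' e2' (MEq x y));
  bf_in m e1 e2 e1' e2' x X : Z m e1 e2 e1' e2' ->
    (sat G e1 e2 (MIn x X) <-> sat G' e1' e2' (MIn x X));
  bf_forth1 m e1 e2 e1' e2' x a : Z (S m) e1 e2 e1' e2' ->
    exists a', Z m (upd e1 x (Some a)) e2 (upd e1' x (Some a')) e2';
  bf_back1 m e1 e2 e1' e2' x a' : Z (S m) e1 e2 e1' e2' ->
    exists a, Z m (upd e1 x (Some a)) e2 (upd e1' x (Some a')) e2';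
  bf_forth2 m e1 e2 e1' e2' X A : Z (S m) e1 e2 e1' e2' ->
    exists A', Z m e1 (upd e2 X A) e1' (upd e2' X A');
  bf_back2 m e1 e2 e1' e2' X A' : Z (S m) e1 e2 e1' e2' ->
    exists A, Z m e1 (upd e2 X A) e1' (upd e2' X A') }.

Lemma back_and_forth_sat (G G' : graph) Z (p : mso) :
  back_and_forth G G' Z ->
  forall m e1 e2 e1' e2', qr p <= m -> Z m e1 e2 e1' e2' ->
    (sat G e1 e2 p <-> sat G' e1' e2' p).
Proof.
  intros B. induction p as [x y|x y|x X|p IH|p IHp q IHq|p IHp q IHq|x p IH|x p IH|X p IH|X p IH];
    intros m e1 e2 e1' e2' Hm HZ.
  - eapply bf_edge; eauto.
  - eapply bf_eq; eauto.
  - eapply bf_in; eauto.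
  - simpl in *. now rewrite (IH m e1 e2 e1' e2').
  - simpl in *. rewrite (IHp m e1 e2 e1' e2'), (IHq m e1 e2 e1' e2') by (auto; lia). tauto.
  - simpl in *. rewrite (IHp m e1 e2 e1' e2'), (IHq m e1 e2 e1' e2') by (auto; lia). tauto.
  - destruct m as [|m]; simpl in *; [lia|]. split; intros [a Ha].
    + destruct (bf_forth1 _ _ _ B _ _ _ _ _ x a HZ) as [a' Ha']. exists a'.
      eapply IH in Ha'; [|lia]. tauto.
    + destruct (bf_back1 _ _ _ B _ _ _ _ _ x a HZ) as [a' Ha']. exists a'.
      eapply IH in Ha'; [|lia]. tauto.
  - destruct m as [|m]; simpl in *; [lia|]. split; intros H a.
    + destruct (bf_back1 _ _ _ B _ _ _ _ _ x a HZ) as [a' Ha']. specialize (H a').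
      eapply IH in Ha'; [|lia]. tauto.
    + destruct (bf_forth1 _ _ _ B _ _ _ _ _ x a HZ) as [a' Ha']. specialize (H a').
      eapply IH in Ha'; [|lia]. tauto.
  - destruct m as [|m]; simpl in *; [lia|]. split; intros [a Ha].
    + destruct (bf_forth2 _ _ _ B _ _ _ _ _ X a HZ) as [a' Ha']. exists a'.
      eapply IH in Ha'; [|lia]. tauto.
    + destruct (bf_back2 _ _ _ B _ _ _ _ _ X a HZ) as [a' Ha']. exists a'.
      eapply IH in Ha'; [|lia]. tauto.
  - destruct m as [|m]; simpl in *; [lia|]. split; intros H a.
    + destruct (bf_back2 _ _ _ B _ _ _ _ _ X a HZ) as [a' Ha']. specialize (H a').
      eapply IH in Ha'; [|lia]. tauto.
    + destruct (bf_forth2 _ _ _ B _ _ _ _ _ X a HZ) as [a' Ha']. specialize (H a').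
      eapply IH in Ha'; [|lia]. tauto.
Qed.

Lemma mso_equiv_iso (m : nat) (G G' : graph) (f : gV G -> gV G') :
  (forall x y, f x = f y -> x = y) -> (forall z, exists x, f x = z) ->
  (forall x y, gE G x y <-> gE G' (f x) (f y)) -> mso_equiv m G G'.
Proof.
  intros Hinj Hsur HE p _ Hqr.
  assert (Hupd : forall e1 e1' x a, (forall y, e1' y = option_map f (e1 y)) ->
     forall y, upd e1' x (Some (f a)) y = option_map f (upd e1 x (Some a) y)).
  { intros e1 e1' x a H y. unfold upd. destruct (Nat.eqb y x); auto. }
  apply (back_and_forth_sat _ _
    (fun _ e1 e2 e1' e2' => (forall x, e1' x = option_map f (e1 x)) /\
                            forall X a, e2 X a <-> e2' X (f a))) with (m := m); auto.
  - split.
    + intros _ e1 e2 e1' e2' x y [H1 H2]. simpl. rewrite !H1.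
      destruct (e1 x), (e1 y); simpl; auto; tauto.
    + intros _ e1 e2 e1' e2' x y [H1 H2]. simpl. rewrite !H1.
      destruct (e1 x), (e1 y); simpl; try tauto. split; [congruence|apply Hinj].
    + intros _ e1 e2 e1' e2' x y [H1 H2]. simpl. rewrite !H1.
      destruct (e1 x); simpl; auto; tauto.
    + intros _ e1 e2 e1' e2' x a [H1 H2]. exists (f a). auto.
    + intros _ e1 e2 e1' e2' x a' [H1 H2]. destruct (Hsur a') as [a <-]. exists a. auto.
    + intros _ e1 e2 e1' e2' X A [H1 H2].
      exists (fun z => exists a, f a = z /\ A a). split; auto.
      intros Y a. unfold upd. destruct (Nat.eqb Y X); auto. split; eauto.
      intros (b & Hb & HA). apply Hinj in Hb. now subst.
    + intros _ e1 e2 e1' e2' X A [H1 H2]. exists (fun a => A (f a)). split; auto.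
      intros Y a. unfold upd. destruct (Nat.eqb Y X); auto; tauto.
  - split; auto. tauto.
Qed.

(** The game is played on leaves; transporting the graphs along [f] lets environments take leaves as
    values. For injective [f] this is an induced subgraph of [G]. *)
Definition pullback (G : graph) {A : Type} (f : A -> gV G) : graph :=
  {| gV := A;
     gE := fun x y => gE G (f x) (f y);
     gE_irr := fun x => gE_irr G (f x);
     gE_sym := fun x y => gE_sym G (f x) (f y) |}.

(** * The Ehrenfeucht-Fraisse game on trees *)

(** [adj] is the set [S] of a model read on colours, with the meeting height in place of half the
    distance. *)
Definition adj_by {k : nat} {t : htree k} {C : Type} (R : leaves k t -> leaves k t -> Prop)
    (c : leaves k t -> C) (adj : C -> C -> nat -> Prop) : Prop :=
  forall x y, R x y <-> exists l, height_meet k t x y l /\ adj (c x) (c y) l.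

(* Every variable in use is read off the colours; first-order variables are colour
   classes with a single element. *)
Definition tree_position (G G' : graph) (k : nat) (t t' : htree k)
    (f : leaves k t -> gV G) (f' : leaves k t' -> gV G') (m : nat)
    (e1 : nat -> option (leaves k t)) (e2 : nat -> leaves k t -> Prop)
    (e1' : nat -> option (leaves k t')) (e2' : nat -> leaves k t' -> Prop) : Prop :=
  exists (n : nat) (C : Type) (c : leaves k t -> C) (c' : leaves k t' -> C),
    1 <= n /\ fin_le C n /\
    type_of k m n C t c = type_of k m n C t' c' /\
    (exists adj, adj_by (fun x y => gE G (f x) (f y)) c adj /\
                 adj_by (fun x y => gE G' (f' x) (f' y)) c' adj) /\
    (forall x, (e1 x = None /\ e1' x = None) \/
       exists a a' (P : C -> Prop), e1 x = Some a /\ e1' x = Some a' /\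
         (forall z, P (c z) <-> z = a) /\ (forall z, P (c' z) <-> z = a')) /\
    (forall X, exists P : C -> Prop, (forall z, e2 X z <-> P (c z)) /\
                                     (forall z, e2' X z <-> P (c' z))).

Lemma tree_position_sym (G G' : graph) (k : nat) (t t' : htree k) f f' m e1 e2 e1' e2' :
  tree_position G G' k t t' f f' m e1 e2 e1' e2' ->
  tree_position G' G k t' t f' f m e1' e2' e1 e2.
Proof.
  intros (n & C & c & c' & Hn & HC & Ht & (adj & Ha & Ha') & H1 & H2).
  exists n, C, c', c. split; auto. split; auto. split; auto. split; [eauto|]. split.
  - intros x. destruct (H1 x) as [[? ?]|(a & a' & P & ? & ? & ? & ?)]; [now left|right].
    exists a', a, P. auto.
  - intros X. destruct (H2 X) as (P & ? & ?). eauto.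
Qed.

(** Both kinds of move start here. The new bit of a colour records membership in [A]; whatever was
    read off the old colour is now read off the first component. *)
Lemma tree_position_extend (G G' : graph) (k : nat) (t t' : htree k) f f' m e1 e2 e1' e2'
    (A : leaves k t -> Prop) :
  tree_position G G' k t t' f f' (S m) e1 e2 e1' e2' ->
  exists (n : nat) (C : Type) (c : leaves k t -> C) (c' : leaves k t' -> C) (P : C -> Prop),
    1 <= n /\ fin_le C n /\
    type_of k m n C t c = type_of k m n C t' c' /\
    (exists adj, adj_by (fun x y => gE G (f x) (f y)) c adj /\
                 adj_by (fun x y => gE G' (f' x) (f' y)) c' adj) /\
    (forall x, (e1 x = None /\ e1' x = None) \/
       exists a a' (P : C -> Prop), e1 x = Some a /\ e1' x = Some a' /\
         (forall z, P (c z) <-> z = a) /\ (forall z, P (c' z) <-> z = a')) /\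
    (forall X, exists P : C -> Prop, (forall z, e2 X z <-> P (c z)) /\
                                     (forall z, e2' X z <-> P (c' z))) /\
    (forall z, A z <-> P (c z)).
Proof.
  intros (n & C & c & c' & Hn & HC & Ht & (adj & Ha & Ha') & H1 & H2).
  destruct (type_of_extend k m n C t t' c c' (fun x => truth (A x)) HC Ht) as [X' HX].
  exists (2 * n), (C * bool)%type, (fun x => (c x, truth (A x))), (fun x => (c' x, X' x)),
    (fun cb => snd cb = true).
  split; [lia|]. split.
  { rewrite Nat.mul_comm. apply fin_le_prod; auto using fin_le_bool. }
  split; [exact HX|]. split.
  { exists (fun p q l => adj (fst p) (fst q) l). split; [exact Ha|exact Ha']. }
  split.
  { intros x. destruct (H1 x) as [?|(a & a' & P & ? & ? & ? & ?)]; [now left|right].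
    exists a, a', (fun cb => P (fst cb)). auto. }
  split.
  { intros X. destruct (H2 X) as (P & ? & ?). exists (fun cb => P (fst cb)). auto. }
  intros z. simpl. symmetry. apply truth_iff.
Qed.

Lemma tree_position_forth2 (G G' : graph) (k : nat) (t t' : htree k) f f' m e1 e2 e1' e2' X A :
  tree_position G G' k t t' f f' (S m) e1 e2 e1' e2' ->
  exists A', tree_position G G' k t t' f f' m e1 (upd e2 X A) e1' (upd e2' X A').
Proof.
  intros H. destruct (tree_position_extend _ _ _ _ _ _ _ _ _ _ _ _ A H)
    as (n & C & c & c' & P & Hn & HC & Ht & Ha & H1 & H2 & HP).
  exists (fun z => P (c' z)). exists n, C, c, c'.
  do 5 (split; auto). intros Y. unfold upd. destruct (Nat.eqb Y X); auto.
  exists P. split; auto. tauto.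
Qed.

Lemma tree_position_forth1 (G G' : graph) (k : nat) (t t' : htree k) f f' m e1 e2 e1' e2' x a :
  tree_position G G' k t t' f f' (S m) e1 e2 e1' e2' ->
  exists a', tree_position G G' k t t' f f' m (upd e1 x (Some a)) e2 (upd e1' x (Some a')) e2'.
Proof.
  intros H. destruct (tree_position_extend _ _ _ _ _ _ _ _ _ _ _ _ (fun z => z = a) H)
    as (n & C & c & c' & P & Hn & HC & Ht & Ha & H1 & H2 & HP).
  destruct (type_of_exists k m n C t t' c c' P Ht) as [a' Ha'].
  { exists a. now apply HP. }
  exists a'. exists n, C, c, c'.
  do 4 (split; auto). split; auto.
  intros y. unfold upd. destruct (Nat.eqb y x); auto. right.
  exists a, a', P. split; auto. split; auto. split; [intros z; symmetry; apply HP|].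
  (* A second leaf satisfying [P] on the answering side would force, through [type_of_two], a second
     element of the singleton that was played. *)
  intros z. split; [|now intros ->]. intros Hz. apply NNPP. intros Hne.
  destruct (type_of_two k m n C t' t c' c P Hn (eq_sym Ht)) as (u & v & Huv & Hu & Hv).
  { exists z, a'. auto. }
  apply HP in Hu, Hv. congruence.
Qed.

Lemma tree_back_and_forth (G G' : graph) (k : nat) (t t' : htree k) f f' :
  back_and_forth (pullback G f) (pullback G' f') (tree_position G G' k t t' f f').
Proof.
  split.
  - intros m e1 e2 e1' e2' x y (n & C & c & c' & Hn & HC & Ht & (adj & Ha & Ha') & H1 & H2).
    simpl. destruct (H1 x) as [[-> ->]|(a & a' & P & -> & -> & HP & HP')]; [tauto|].
    destruct (H1 y) as [[-> ->]|(b & b' & Q & -> & -> & HQ & HQ')]; [tauto|].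
    rewrite (Ha a b), (Ha' a' b').
    (* Partners have equal colours: [P] together with the exact colour of [a] is realised on the
       other side, where only [a'] satisfies [P]. *)
    assert (Hcol : forall (P : C -> Prop) a a', (forall z, P (c z) <-> z = a) ->
              (forall z, P (c' z) <-> z = a') -> c a = c' a').
    { clear - Ht. intros P a a' HP HP'.
      destruct (type_of_exists k m n C t t' c c' (fun s => P s /\ s = c a) Ht) as [z [Hz E]].
      - exists a. split; auto. now apply HP.
      - apply HP' in Hz. congruence. }
    rewrite (Hcol P a a' HP HP'), (Hcol Q b b' HQ HQ').
    split; intros (l & Hl & Hadj); exists l; split; auto.
    + eapply (type_of_height_meet k m n C t t' c c' P Q); eauto.
    + eapply (type_of_height_meet k m n C t' t c' c P Q); eauto.
  - intros m e1 e2 e1' e2' x y (n & C & c & c' & Hn & HC & Ht & _ & H1 & H2).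
    simpl. destruct (H1 x) as [[-> ->]|(a & a' & P & -> & -> & HP & HP')]; [tauto|].
    destruct (H1 y) as [[-> ->]|(b & b' & Q & -> & -> & HQ & HQ')]; [tauto|].
    split; intros <-.
    + destruct (type_of_exists k m n C t t' c c' (fun s => P s /\ Q s) Ht) as [z [Hz Hz']].
      * exists a. split; [now apply HP|now apply HQ].
      * apply HP' in Hz. apply HQ' in Hz'. congruence.
    + destruct (type_of_exists k m n C t' t c' c (fun s => P s /\ Q s) (eq_sym Ht))
        as [z [Hz Hz']].
      * exists a'. split; [now apply HP'|now apply HQ'].
      * apply HP in Hz. apply HQ in Hz'. congruence.
  - intros m e1 e2 e1' e2' x X (n & C & c & c' & Hn & HC & Ht & _ & H1 & H2).
    simpl. destruct (H1 x) as [[-> ->]|(a & a' & P & -> & -> & HP & HP')]; [tauto|].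
    destruct (H2 X) as (Q & HQ & HQ'). rewrite HQ, HQ'. split; intros H.
    + destruct (type_of_exists k m n C t t' c c' (fun s => P s /\ Q s) Ht) as [z [Hz Hz']].
      * exists a. split; auto. now apply HP.
      * apply HP' in Hz. congruence.
    + destruct (type_of_exists k m n C t' t c' c (fun s => P s /\ Q s) (eq_sym Ht))
        as [z [Hz Hz']].
      * exists a'. split; auto. now apply HP'.
      * apply HP in Hz. congruence.
  - intros. now apply tree_position_forth1.
  - intros m e1 e2 e1' e2' x a' H. apply tree_position_sym in H.
    destruct (tree_position_forth1 _ _ _ _ _ _ _ _ _ _ _ _ x a' H) as [a Ha].
    exists a. now apply tree_position_sym.
  - intros. now apply tree_position_forth2.
  - intros m e1 e2 e1' e2' X A' H. apply tree_position_sym in H.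
    destruct (tree_position_forth2 _ _ _ _ _ _ _ _ _ _ _ _ X A' H) as [A HA].
    exists A. now apply tree_position_sym.
Qed.

Lemma type_of_mso_equiv (G G' : graph) (k m n : nat) (C : Type) (t t' : htree k)
    (f : leaves k t -> gV G) (f' : leaves k t' -> gV G')
    (c : leaves k t -> C) (c' : leaves k t' -> C) (adj : C -> C -> nat -> Prop) :
  1 <= n -> fin_le C n ->
  type_of k m n C t c = type_of k m n C t' c' ->
  adj_by (fun x y => gE G (f x) (f y)) c adj ->
  adj_by (fun x y => gE G' (f' x) (f' y)) c' adj ->
  mso_equiv m (pullback G f) (pullback G' f').
Proof.
  intros Hn HC Ht Ha Ha' p _ Hqr.
  apply (back_and_forth_sat _ _ _ p (tree_back_and_forth G G' k t t' f f') m); auto.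
  exists n, C, c, c'. split; auto. split; auto. split; auto. split; [eauto|]. split.
  - intros x. now left.
  - intros X. exists (fun _ => False). split; tauto.
Qed.

(** * Parents and distances in rooted trees *)

Lemma walk_app {N : Type} (E : N -> N -> Prop) (x y z : N) (n p : nat) :
  walk E x y n -> walk E y z p -> walk E x z (n + p).
Proof. induction 1; simpl; auto. intros. econstructor; eauto. Qed.

Lemma walk_1 {N : Type} (E : N -> N -> Prop) (x y : N) : E x y -> walk E x y 1.
Proof. intros. econstructor; eauto. constructor. Qed.

Lemma walk_rev {N : Type} (E : N -> N -> Prop) (x y : N) (n : nat) :
  (forall x y, E x y -> E y x) -> walk E x y n -> walk E y x n.
Proof.
  intros Hs. induction 1 as [|x y z n HE Hw IH]; [constructor|].
  rewrite <- Nat.add_1_r. eapply walk_app; eauto. apply walk_1. auto.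
Qed.

Lemma walk_map {N N' : Type} (E : N -> N -> Prop) (E' : N' -> N' -> Prop) (f : N -> N')
    (x y : N) (n : nat) :
  (forall x y, E x y -> E' (f x) (f y)) -> walk E x y n -> walk E' (f x) (f y) n.
Proof. intros H. induction 1; econstructor; eauto. Qed.

Lemma walk_last {N : Type} (E : N -> N -> Prop) (x z : N) (n : nat) :
  walk E x z (S n) -> exists y, walk E x y n /\ E y z.
Proof.
  revert x. induction n as [|n IH]; intros x H; inversion H as [|? y ? ? HE Hw]; subst.
  - inversion Hw; subst. exists x. split; auto. constructor.
  - destruct (IH y Hw) as (u & Hu & HE'). exists u. split; auto. econstructor; eauto.
Qed.

Lemma dist_unique {N : Type} (E : N -> N -> Prop) (x y : N) (n p : nat) :
  dist E x y n -> dist E x y p -> n = p.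
Proof. intros [H1 H2] [H3 H4]. apply H2 in H3. apply H4 in H1. lia. Qed.

Lemma dist_exists {N : Type} (E : N -> N -> Prop) (x y : N) (n : nat) :
  walk E x y n -> exists p, p <= n /\ dist E x y p.
Proof.
  intros H. destruct (least_witness (walk E x y) n H) as (p & Hp & Hw & Hm).
  exists p. split; auto. split; auto. intros k Hk.
  apply Nat.nlt_ge. intros Hlt. exact (Hm k Hlt Hk).
Qed.

Lemma dist_pred {N : Type} (E : N -> N -> Prop) (r x : N) (n : nat) :
  dist E r x (S n) -> exists y, E y x /\ dist E r y n.
Proof.
  intros [Hw Hm]. apply walk_last in Hw. destruct Hw as (y & Hw & HE).
  exists y. split; auto. split; auto. intros k Hk.
  assert (S n <= k + 1); [|lia]. apply Hm. eapply walk_app; eauto. now apply walk_1.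
Qed.

Lemma chain_app_last {N : Type} (E : N -> N -> Prop) (l : list N) (x y z : N) :
  chain E (x :: l ++ [y]) -> E y z -> chain E (x :: (l ++ [y]) ++ [z]).
Proof.
  revert x. induction l as [|a l IH]; intros x H HE.
  - simpl in *. tauto.
  - destruct H as [H1 H2]. split; [exact H1|]. now apply IH.
Qed.

(* A path joining two vertices of the same depth through strictly deeper vertices
   closes up to a cycle: extend it towards the root at both ends until the ends meet. *)
Lemma no_bridge {N : Type} (E : N -> N -> Prop) (r : N) (n : nat) :
  is_tree E -> forall u v l,
  dist E r u n -> dist E r v n -> u <> v ->
  NoDup (u :: l ++ [v]) -> chain E (u :: l ++ [v]) ->
  (forall w p, In w l -> dist E r w p -> n < p) -> False.
Proof.
  intros (Hirr & Hsym & Hcon & Hcyc).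
  induction n as [|n IH]; intros u v l Hu Hv Huv Hd Hc Hdeep.
  - destruct Hu as [Hu _], Hv as [Hv _]. inversion Hu; inversion Hv; subst. tauto.
  - destruct (dist_pred E r u n Hu) as (u' & Eu & Hu').
    destruct (dist_pred E r v n Hv) as (v' & Ev & Hv').
    assert (Hout : forall w, dist E r w n -> ~ In w (u :: l ++ [v])).
    { intros w Hw [<-|Hin]; [pose proof (dist_unique _ _ _ _ _ Hw Hu); lia|].
      apply in_app_or in Hin. destruct Hin as [Hin|[<-|[]]].
      - specialize (Hdeep w n Hin Hw). lia.
      - pose proof (dist_unique _ _ _ _ _ Hw Hv); lia. }
    destruct (classic (u' = v')) as [<-|Hne].
    + apply Hcyc. exists u', (u :: l ++ [v]). split; [constructor; auto|].
      split; [simpl; rewrite length_app; simpl; lia|].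
      split; [split; auto|].
      change (u :: l ++ [v]) with ((u :: l) ++ [v]). rewrite last_last. auto.
    + apply (IH u' v' (u :: l ++ [v])); auto.
      * constructor.
        -- intros Hin. apply in_app_or in Hin. destruct Hin as [Hin|[Hin|[]]].
           ++ exact (Hout u' Hu' Hin).
           ++ congruence.
        -- apply NoDup_app; [auto|repeat constructor; auto|].
           intros w Hw [<-|[]]. exact (Hout v' Hv' Hw).
      * split; [auto|]. apply chain_app_last; auto.
      * intros w p [<-|Hin] Hp.
        -- pose proof (dist_unique _ _ _ _ _ Hp Hu). lia.
        -- apply in_app_or in Hin. destruct Hin as [Hin|[<-|[]]].
           ++ specialize (Hdeep w p Hin Hp). lia.
           ++ pose proof (dist_unique _ _ _ _ _ Hp Hv). lia.
Qed.

(* [dep] is the depth; the root is its own parent. *)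
Record parent_of {N : Type} (E : N -> N -> Prop) (r : N) (par : N -> N) (dep : N -> nat)
    : Prop := {
  dep_dist x : dist E r x (dep x);
  dep_root : dep r = 0;
  par_root : par r = r;
  par_edge x : x <> r -> E x (par x);
  par_dep x : x <> r -> dep x = S (dep (par x));
  edge_par x y : E x y -> y = par x \/ x = par y }.

(** By [no_bridge], [y] cannot have two parents, since [y] itself would bridge them, and no edge
    joins equal depths, since it would be a bridge with empty interior. Depths of neighbours differ
    by at most one, so every edge joins a node to its parent. *)
Lemma tree_parent {N : Type} (E : N -> N -> Prop) (r : N) :
  is_tree E -> exists par dep, parent_of E r par dep.
Proof.
  intros Ht. assert (Ht' := Ht). destruct Ht' as (Hirr & Hsym & Hcon & Hcyc).
  assert (Hdep : forall x, exists n, dist E r x n).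
  { intros x. destruct (Hcon r x) as [n Hn]. destruct (dist_exists _ _ _ _ Hn) as (p & _ & Hp).
    eauto. }
  apply dep_choice in Hdep. destruct Hdep as [dep Hdep].
  assert (Hr : dep r = 0).
  { apply (dist_unique E r r); auto. split; [constructor|lia]. }
  assert (H0 : forall x, dep x = 0 -> x = r).
  { intros x Hx. specialize (Hdep x). rewrite Hx in Hdep. destruct Hdep as [Hw _].
    inversion Hw. auto. }
  assert (Hpar : forall x, exists y, (x = r /\ y = r) \/ (x <> r /\ E x y /\ dep x = S (dep y))).
  { intros x. destruct (classic (x = r)) as [->|Hx]; [eauto|].
    pose proof (Hdep x) as Hd. destruct (dep x) as [|n] eqn:En; [now apply H0 in En|].
    destruct (dist_pred E r x n Hd) as (y & HE & Hy). exists y. right.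
    split; auto. split; auto. now rewrite (dist_unique _ _ _ _ _ (Hdep y) Hy). }
  apply dep_choice in Hpar. destruct Hpar as [par Hpar].
  assert (Hsucc : forall x y, E x y -> dep y = S (dep x) -> x = par y).
  { intros x y HE Hd. destruct (Hpar y) as [[-> _]|(Hy & HE' & Hd')]; [lia|].
    apply NNPP. intros Hne.
    assert (Hx : dist E r (par y) (dep x)) by (replace (dep x) with (dep (par y)) by lia; auto).
    apply (no_bridge E r (dep x) Ht x (par y) [y]); auto.
    - simpl. constructor.
      + intros [Ex|[Ex|[]]]; [|now rewrite Ex in Hne]. subst y. now apply (Hirr x).
      + repeat constructor; auto. intros [Ey|[]]. rewrite Ey in HE'. now apply (Hirr y).
    - simpl. auto.
    - intros w p [<-|[]] Hp. pose proof (dist_unique _ _ _ _ _ Hp (Hdep y)). lia. }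
  exists par, dep. split; auto.
  - destruct (Hpar r) as [[_ ?]|[? _]]; tauto.
  - intros x Hx. destruct (Hpar x) as [[? _]|[_ [? _]]]; tauto.
  - intros x Hx. destruct (Hpar x) as [[? _]|[_ [_ ?]]]; tauto.
  - intros x y HE.
    assert (Hle : forall x y, E x y -> dep y <= S (dep x)).
    { clear - Hdep. intros x y HE. apply (Hdep y). rewrite <- Nat.add_1_r.
      eapply walk_app; [apply Hdep|now apply walk_1]. }
    pose proof (Hle x y HE). pose proof (Hle y x (Hsym _ _ HE)).
    destruct (Nat.eq_dec (dep y) (S (dep x))); [right; auto|].
    destruct (Nat.eq_dec (dep x) (S (dep y))); [left; auto|].
    exfalso. assert (Hxy : dep x = dep y) by lia.
    apply (no_bridge E r (dep x) Ht x y []); auto.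
    + now rewrite Hxy.
    + intros ->. now apply (Hirr y).
    + simpl. constructor; [intros [->|[]]; now apply (Hirr x)|repeat constructor; auto].
    + simpl. auto.
    + intros w p [].
Qed.

Definition anc {N : Type} (par : N -> N) (k : nat) (x : N) : N := Nat.iter k par x.

Lemma anc_par {N : Type} (par : N -> N) (k : nat) (x : N) : anc par k (par x) = anc par (S k) x.
Proof. unfold anc. symmetry. apply Nat.iter_succ_r. Qed.

Lemma anc_add {N : Type} (par : N -> N) (k j : nat) (x : N) :
  anc par k (anc par j x) = anc par (k + j) x.
Proof. unfold anc. symmetry. apply Nat.iter_add. Qed.

Lemma dep_eq_0 {N : Type} (E : N -> N -> Prop) (r : N) par dep (x : N) :
  parent_of E r par dep -> dep x = 0 -> x = r.
Proof.
  intros Hp Hx. apply NNPP. intros Hne. apply (par_dep _ _ _ _ Hp) in Hne. lia.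
Qed.

Lemma dep_anc {N : Type} (E : N -> N -> Prop) (r : N) par dep (k : nat) (x : N) :
  parent_of E r par dep -> dep (anc par k x) = dep x - k.
Proof.
  intros Hp. induction k as [|k IH]; simpl; [lia|]. fold (anc par k x).
  destruct (classic (anc par k x = r)) as [Er|Hne].
  - rewrite Er, (par_root _ _ _ _ Hp), (dep_root _ _ _ _ Hp).
    rewrite Er, (dep_root _ _ _ _ Hp) in IH. lia.
  - apply (par_dep _ _ _ _ Hp) in Hne. lia.
Qed.

Lemma anc_deep {N : Type} (E : N -> N -> Prop) (r : N) par dep (k : nat) (x : N) :
  parent_of E r par dep -> dep x <= k -> anc par k x = r.
Proof.
  intros Hp Hk. eapply dep_eq_0; eauto. erewrite dep_anc; eauto. lia.
Qed.

(** Each edge goes to the parent or to a child, so putting it in front of a walk lengthens or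
    shortens the climb from the start by one; a downward edge in front of an empty climb is charged
    to the climb from the other end. *)
Lemma walk_common_anc {N : Type} (E : N -> N -> Prop) (r : N) par dep (x y : N) (n : nat) :
  parent_of E r par dep -> walk E x y n ->
  exists a b, a + b <= n /\ anc par a x = anc par b y.
Proof.
  intros Hp. induction 1 as [x|x y z n HE Hw (a & b & Hab & Heq)].
  - exists 0, 0. auto.
  - destruct (edge_par _ _ _ _ Hp _ _ HE) as [->| ->].
    + exists (S a), b. split; [lia|]. now rewrite <- anc_par.
    + destruct a as [|a].
      * exists 0, (S b). split; [lia|]. simpl in *. now rewrite Heq.
      * exists a, b. split; [lia|]. now rewrite anc_par.
Qed.

Lemma walk_anc {N : Type} (E : N -> N -> Prop) (r : N) par dep (k : nat) (x : N) :
  parent_of E r par dep -> k <= dep x -> walk E x (anc par k x) k.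
Proof.
  intros Hp Hk. induction k as [|k IH]; [constructor|].
  rewrite <- Nat.add_1_r at 2. eapply walk_app; [apply IH; lia|].
  apply walk_1. simpl. apply (par_edge _ _ _ _ Hp). fold (anc par k x). intros Er.
  pose proof (dep_anc _ _ _ _ k x Hp) as H. rewrite Er, (dep_root _ _ _ _ Hp) in H. lia.
Qed.

Lemma dist_common_anc {N : Type} (E : N -> N -> Prop) (r : N) par dep (x y : N) (l : nat) :
  (forall x y, E x y -> E y x) ->
  parent_of E r par dep -> dep x = dep y ->
  (dist E x y (2 * l) <->
   anc par l x = anc par l y /\ forall j, j < l -> anc par j x <> anc par j y).
Proof.
  intros Hsym Hp Hxy.
  assert (Hcommon : forall n, walk E x y n -> exists j, 2 * j <= n /\ anc par j x = anc par j y).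
  { intros n Hw. destruct (walk_common_anc _ _ _ _ _ _ _ Hp Hw) as (a & b & Hab & Heq).
    pose proof (f_equal dep Heq) as Hd. rewrite !(dep_anc _ _ _ _ _ _ Hp) in Hd.
    (* At equal depths, climbs of different lengths can meet only at the root, where [par] is
       stationary; the shorter length then suffices for both. *)
    destruct (Nat.eq_dec a b) as [<-|Hne]; [exists a; split; auto; lia|].
    exists (Nat.min a b). split; [lia|].
    rewrite !(anc_deep E r par dep (Nat.min a b)); auto; lia. }
  (* A climb past the root is cut off at the depth of [x], so the walk may be shorter than
     [2 * j]. *)
  assert (Hwalk : forall j, anc par j x = anc par j y -> exists i, i <= j /\ walk E x y (2 * i)).
  { intros j Hj. destruct (le_lt_dec j (dep x)) as [Hle|Hlt].
    - exists j. split; auto. replace (2 * j) with (j + j) by lia.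
      eapply walk_app; [eapply walk_anc; eauto|]. rewrite Hj. apply walk_rev; auto.
      eapply walk_anc; eauto. lia.
    - exists (dep x). split; [lia|]. replace (2 * dep x) with (dep x + dep x) by lia.
      eapply walk_app; [eapply (walk_anc _ _ _ _ (dep x)); eauto|].
      rewrite (anc_deep E r par dep (dep x) x), <- (anc_deep E r par dep (dep y) y) by (auto; lia).
      rewrite Hxy. apply walk_rev; auto. eapply walk_anc; eauto. }
  split.
  - intros [Hw Hmin]. destruct (Hcommon _ Hw) as (j & Hj & Heq).
    destruct (Hwalk j Heq) as (i & Hi & Hwi). apply Hmin in Hwi.
    assert (j = l) by lia. subst j. split; auto.
    intros j Hjl Hj'. destruct (Hwalk j Hj') as (i' & Hi' & Hwi'). apply Hmin in Hwi'. lia.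
  - intros [Heq Hmin].
    assert (Hlow : forall n, walk E x y n -> 2 * l <= n).
    { intros n Hn. destruct (Hcommon n Hn) as (j & Hj & Hej).
      destruct (le_lt_dec l j); [lia|]. destruct (Hmin j); auto. }
    split; auto. destruct (Hwalk l Heq) as (i & Hi & Hwi).
    pose proof (Hlow _ Hwi). now replace l with i by lia.
Qed.

(** * Tree models of induced subgraphs *)

Lemma sig_eq {A : Type} (P : A -> Prop) (x y : {a | P a}) : proj1_sig x = proj1_sig y -> x = y.
Proof. destruct x, y. apply subset_eq_compat. Qed.

Lemma has_cycle_map {N N' : Type} (E : N -> N -> Prop) (E' : N' -> N' -> Prop) (f : N -> N') :
  (forall x y, f x = f y -> x = y) -> (forall x y, E x y -> E' (f x) (f y)) ->
  has_cycle E -> has_cycle E'.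
Proof.
  intros Hinj HE (x & l & Hd & Hl & Hc & Hlast). exists (f x), (map f l).
  split; [|split; [|split]].
  - change (NoDup (map f (x :: l))). apply NoDup_map_NoDup_ForallPairs; auto.
    intros a b _ _. apply Hinj.
  - now rewrite length_map.
  - clear - HE Hc. revert x Hc. induction l as [|y l IH]; intros x Hc; simpl; auto.
    destruct Hc as [H1 H2]. split; auto. now apply IH.
  - assert (Hm : forall z, last (map f l) (f z) = f (last l z)).
    { clear. induction l as [|y [|y' l] IH]; intros z; auto. apply (IH z). }
    rewrite Hm. auto.
Qed.

(** The model of [H] consists of the ancestors of its leaves. It contains their common ancestors, so
    distances are preserved and [S] can be kept. Without any vertex in [H] even the root would be
    missing. *)
Lemma TM_induced_sub (r d : nat) (G H : graph) :
  TM r d G -> induced_sub H G -> inhabited (gV H) -> TM r d H.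
Proof.
  intros (N & E & root & lab & S0 & (Htree & Hlab & Hleafd & Hleaflab & Hint & HSb & HSs)
          & f & Hfinj & Hfsur & Hfadj) (g & Hginj & Hgadj) [h0].
  destruct (tree_parent E root Htree) as (par & dep & Hp).
  destruct Htree as (Hirr & Hsym & Hcon & Hcyc).
  set (nd := fun h => proj1_sig (f (g h))).
  assert (Hleaf : forall h, leaf E root (nd h)) by (intros h; apply proj2_sig).
  assert (Hdep : forall h, dep (nd h) = d).
  { intros h. eapply dist_unique; [apply (dep_dist _ _ _ _ Hp)|auto]. }
  set (PM := fun x : N => exists h k, x = anc par k (nd h)).
  set (M := {x : N | PM x}).
  set (E' := fun x y : M => E (proj1_sig x) (proj1_sig y)).
  assert (Hanc : forall (x : M) a, exists y : M, proj1_sig y = anc par a (proj1_sig x)).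
  { intros [x (h & k & ->)] a.
    assert (Hin : PM (anc par a (anc par k (nd h)))).
    { exists h, (a + k). apply anc_add. }
    exists (exist PM _ Hin). reflexivity. }
  assert (Hclimb : forall a (x y : M), proj1_sig y = anc par a (proj1_sig x) ->
            exists n, n <= a /\ walk E' x y n).
  { induction a as [|a IH]; intros x y Hy.
    - apply sig_eq in Hy. subst. exists 0. split; auto. constructor.
    - destruct (classic (proj1_sig x = root)) as [Hx|Hx].
      + destruct (IH x y) as (n & Hn & Hw); [|exists n; split; auto; lia].
        rewrite Hy, <- anc_par, Hx, (par_root _ _ _ _ Hp). auto.
      + destruct (Hanc x 1) as [z Hz]. destruct (IH z y) as (n & Hn & Hw).
        * rewrite Hz, anc_add. now rewrite Nat.add_1_r.
        * exists (S n). split; [lia|]. econstructor; eauto. unfold E'. rewrite Hz.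
          now apply (par_edge _ _ _ _ Hp). }
  assert (Hsym' : forall x y, E' x y -> E' y x) by (intros x y; apply Hsym).
  (* A walk that leaves the subtree is replaced by two climbs to a common ancestor, together at most
     as long and inside the subtree. *)
  assert (Hsub : forall x y n, walk E (proj1_sig x) (proj1_sig y) n ->
            exists n', n' <= n /\ walk E' x y n').
  { intros x y n Hw. destruct (walk_common_anc _ _ _ _ _ _ _ Hp Hw) as (a & b & Hab & Heq).
    destruct (Hanc x a) as [z Hz].
    destruct (Hclimb a x z Hz) as (n1 & Hn1 & Hw1).
    destruct (Hclimb b y z) as (n2 & Hn2 & Hw2); [congruence|].
    exists (n1 + n2). split; [lia|]. eapply walk_app; eauto. now apply walk_rev. }
  assert (Hmap : forall x y n, walk E' x y n -> walk E (proj1_sig x) (proj1_sig y) n).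
  { intros x y n. apply walk_map. auto. }
  assert (Hdist : forall x y n, dist E' x y n <-> dist E (proj1_sig x) (proj1_sig y) n).
  { intros x y n. split; intros [Hw Hm].
    - split; auto. intros k Hk. destruct (Hsub _ _ _ Hk) as (k' & Hk' & Hw'). apply Hm in Hw'. lia.
    - destruct (Hsub _ _ _ Hw) as (n' & Hn' & Hw'). pose proof (Hm _ (Hmap _ _ _ Hw')).
      replace n with n' by lia. split; auto. intros k Hk. apply Hmap, Hm in Hk. lia. }
  assert (Hroot : PM root).
  { exists h0, d. symmetry. eapply anc_deep; eauto. now rewrite Hdep. }
  set (root' := exist PM root Hroot : M).
  assert (Hchild : forall x y, child E' root' x y -> child E root (proj1_sig x) (proj1_sig y)).
  { intros x y (HE & n & H1 & H2). split; auto. exists n. split; [apply (Hdist root' x)|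
      apply (Hdist root' y)]; auto. }
  assert (Hleaf' : forall x, leaf E' root' x <-> exists h, proj1_sig x = nd h).
  { intros x. split.
    - intros Hx. destruct x as [x Hin]. simpl.
      (* Climbs beyond [d] only repeat the root, so the number of steps may be taken at most [d]; if
         it is positive, the node one step earlier is a child. *)
      assert (Hin' : exists h k, k <= d /\ x = anc par k (nd h)).
      { destruct Hin as (h & k & Hk). destruct (le_lt_dec k d) as [Hle|Hlt]; [eauto|].
        exists h, d. split; auto. rewrite Hk.
        rewrite !(anc_deep E root par dep); auto; rewrite Hdep; lia. }
      destruct Hin' as (h & [|k] & Hkd & Hk); [eauto|]. destruct Hx.
      assert (Hw : PM (anc par k (nd h))) by (exists h, k; auto).
      exists (exist PM _ Hw).
      assert (Hd1 : dep (anc par k (nd h)) = d - k) by (erewrite dep_anc, Hdep; eauto).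
      assert (Hd2 : dep x = d - S k) by (rewrite Hk; erewrite dep_anc, Hdep; eauto).
      split.
      + unfold E'. simpl. rewrite Hk. apply Hsym. simpl. apply (par_edge _ _ _ _ Hp).
        intros Er. fold (anc par k (nd h)) in Er. rewrite Er, (dep_root _ _ _ _ Hp) in Hd1. lia.
      + exists (dep x). split; apply Hdist; simpl.
        * apply (dep_dist _ _ _ _ Hp).
        * replace (S (dep x)) with (dep (anc par k (nd h))) by lia. apply (dep_dist _ _ _ _ Hp).
    - intros [h Hh] [w Hw]. apply Hchild in Hw. rewrite Hh in Hw. apply (Hleaf h). eauto. }
  exists M, E', root', (fun x => lab (proj1_sig x)), S0. split.
  { split; [|split; [|split; [|split; [|split; [|split]]]]]; auto.
    - split; [|split; [|split]]; auto.
      + intros x. apply Hirr.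
      + intros x y. destruct (Hcon (proj1_sig x) (proj1_sig y)) as [n Hn].
        destruct (Hsub _ _ _ Hn) as (n' & _ & Hw). eauto.
      + intros Hc. apply Hcyc. revert Hc. apply (has_cycle_map E' E (@proj1_sig _ _)); auto.
        intros x y. apply sig_eq.
    - intros x Hx. apply Hdist. apply Hleaf' in Hx. destruct Hx as [h Hh]. rewrite Hh.
      now apply Hleafd.
    - intros x Hx. apply Hleaf' in Hx. destruct Hx as [h Hh]. rewrite Hh. now apply Hleaflab.
    - intros x Hx. apply Hint. intros Hl. apply Hx. intros [w Hw]. apply Hl.
      apply Hchild in Hw. eauto. }
  assert (Hnd : forall h, exists x : M, proj1_sig x = nd h).
  { intros h. assert (Hin : PM (nd h)) by (exists h, 0; auto).
    exists (exist PM _ Hin). reflexivity. }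
  apply dep_choice in Hnd. destruct Hnd as [q Hq].
  exists (fun h => exist _ (q h) (proj2 (Hleaf' (q h)) (ex_intro _ h (Hq h)))).
  split; [|split].
  - intros x y Hxy. apply (f_equal (@proj1_sig _ _)) in Hxy. simpl in Hxy.
    apply (f_equal (@proj1_sig _ _)) in Hxy. rewrite !Hq in Hxy.
    apply sig_eq in Hxy. apply Hginj. now apply Hfinj.
  - intros [w Hw]. destruct (proj1 (Hleaf' w) Hw) as [h Hh]. exists h.
    apply sig_eq. simpl. apply sig_eq. now rewrite Hq.
  - intros x y. rewrite Hgadj, Hfadj. unfold model_adj. simpl. rewrite !Hq.
    split; intros (l & Hl & HS); exists l; split; auto.
    + apply Hdist. rewrite !Hq. exact Hl.
    + apply Hdist in Hl. rewrite !Hq in Hl. exact Hl.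
Qed.

(** * Unfolding a tree model *)

(** Only nodes above a vertex are kept; cutting a leafless branch of the model at height 0 would
    create leaves that are not vertices. *)
Fixpoint unfold_tree {V N : Type} (nd : V -> N) (par : N -> N) (k : nat) (x : N) : htree k :=
  match k with
  | 0 => tt
  | S k' => existT (fun I => I -> htree k')
              {y : N | exists v, anc par k' (nd v) = y /\ par y = x}
              (fun y => unfold_tree nd par k' (proj1_sig y))
  end.

Fixpoint leaf_node {V N : Type} (nd : V -> N) (par : N -> N) (k : nat) :
    forall x : N, leaves k (unfold_tree nd par k x) -> N :=
  match k return forall x : N, leaves k (unfold_tree nd par k x) -> N with
  | 0 => fun x _ => x
  | S k' => fun x l => leaf_node nd par k' (proj1_sig (projT1 l)) (projT2 l)
  end.

Lemma leaf_node_origin {V N : Type} (nd : V -> N) (par : N -> N) (k : nat) (x : N)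
    (l : leaves k (unfold_tree nd par k x)) :
  (exists v, anc par k (nd v) = x) ->
  exists v, nd v = leaf_node nd par k x l /\ anc par k (nd v) = x.
Proof.
  revert x l. induction k as [|k IH]; intros x l Hx.
  - destruct Hx as [v Hv]. exists v. auto.
  - destruct l as [[y (v & Hv & Hy)] l]. simpl in *.
    destruct (IH y l) as (w & Hw & Hwy); [eauto|]. exists w. split; auto.
    fold (anc par k (nd w)). now rewrite Hwy.
Qed.

Lemma leaf_node_surj {V N : Type} (nd : V -> N) (par : N -> N) (k : nat) (x : N) (v : V) :
  anc par k (nd v) = x -> exists l, leaf_node nd par k x l = nd v.
Proof.
  revert x. induction k as [|k IH]; intros x Hx.
  - exists tt. auto.
  - destruct (IH (anc par k (nd v)) eq_refl) as [l Hl].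
    exists (existT (fun y : {y : N | exists v, anc par k (nd v) = y /\ par y = x} =>
                      leaves k (unfold_tree nd par k (proj1_sig y)))
              (exist _ (anc par k (nd v)) (ex_intro _ v (conj eq_refl Hx))) l).
    exact Hl.
Qed.

Lemma height_meet_anc {V N : Type} (nd : V -> N) (par : N -> N) (k : nat) (x : N)
    (l l' : leaves k (unfold_tree nd par k x)) (n : nat) :
  (exists v, anc par k (nd v) = x) -> height_meet k _ l l' n ->
  anc par n (leaf_node nd par k x l) = anc par n (leaf_node nd par k x l') /\
  forall j, j < n -> anc par j (leaf_node nd par k x l) <> anc par j (leaf_node nd par k x l').
Proof.
  revert x l l'. induction k as [|k IH]; intros x l l' Hx Hm.
  - simpl in Hm. subst. split; auto. lia.
  - simpl in Hm. destruct Hm as [(y & a & b & -> & -> & Hm)|[Hne ->]].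
    + simpl. apply IH; auto. destruct y as [y (v & Hv & Hy)]. simpl. eauto.
    + destruct l as [[y Hy] a], l' as [[y' Hy'] b]. simpl projT1 in Hne.
      pose proof Hy as Hy0. pose proof Hy' as Hy0'.
      assert (Ha : anc par k (leaf_node nd par k y a) = y).
      { destruct (leaf_node_origin nd par k y a) as (v & <- & Hv); auto.
        destruct Hy0 as (v & Hv & _). eauto. }
      assert (Hb : anc par k (leaf_node nd par k y' b) = y').
      { destruct (leaf_node_origin nd par k y' b) as (v & <- & Hv); auto.
        destruct Hy0' as (v & Hv & _). eauto. }
      simpl leaf_node. split.
      * simpl. fold (anc par k (leaf_node nd par k y a)) (anc par k (leaf_node nd par k y' b)).
        rewrite Ha, Hb. transitivity x; [|symmetry].
        -- now destruct Hy0 as (? & _ & ?).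
        -- now destruct Hy0' as (? & _ & ?).
      (* Equal [j]-th ancestors with [j] at most [k] would give equal [k]-th ancestors, namely the
         two distinct children. *)
      * intros j Hj Heq. apply Hne. apply sig_eq. simpl.
        assert (Hk : forall z, anc par k z = anc par (k - j) (anc par j z)).
        { intros z. rewrite anc_add. f_equal. lia. }
        rewrite Hk in Ha, Hb. simpl in Heq. rewrite Heq in Ha. congruence.
Qed.

Lemma TM_htree (r d : nat) (G : graph) :
  TM r d G -> inhabited (gV G) ->
  exists (t : htree d) (f : leaves d t -> gV G) (c : leaves d t -> upto r)
         (adj : upto r -> upto r -> nat -> Prop),
    (forall x y, f x = f y -> x = y) /\ (forall v, exists x, f x = v) /\
    adj_by (fun x y => gE G (f x) (f y)) c adj.
Proof.
  intros (N & E & root & lab & S0 & (Htree & Hlab & Hleafd & Hleaflab & Hint & HSb & HSs)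
          & f & Hfinj & Hfsur & Hfadj) [v0].
  destruct (tree_parent E root Htree) as (par & dep & Hp).
  destruct Htree as (Hirr & Hsym & Hcon & Hcyc).
  set (nd := fun v => proj1_sig (f v)).
  assert (Hnd : forall v w, nd v = nd w -> v = w).
  { intros v w H. apply Hfinj. now apply sig_eq. }
  assert (Hleaf : forall v, leaf E root (nd v)) by (intros v; apply proj2_sig).
  assert (Hdep : forall v, dep (nd v) = d).
  { intros h. eapply dist_unique; [apply (dep_dist _ _ _ _ Hp)|auto]. }
  assert (Hroot : forall v, anc par d (nd v) = root).
  { intros v. eapply anc_deep; eauto. now rewrite Hdep. }
  assert (Hex : exists v, anc par d (nd v) = root) by (exists v0; auto).
  set (t := unfold_tree nd par d root).
  set (ln := leaf_node nd par d root : leaves d t -> N).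
  assert (Hg : forall l : leaves d t, exists v, nd v = ln l).
  { intros l. destruct (leaf_node_origin nd par d root l Hex) as (v & Hv & _). eauto. }
  apply dep_choice in Hg. destruct Hg as [g Hg].
  assert (Hmeet : forall x y l, height_meet d t x y l -> forall l',
     (dist E (nd (g x)) (nd (g y)) (2 * l') <-> l' = l)).
  { intros x y l Hl l'. destruct (height_meet_anc nd par d root x y l Hex Hl) as [H1 H2].
    rewrite (dist_common_anc E root par dep) by (auto; now rewrite !Hdep).
    rewrite !Hg. split.
    - intros [H3 H4]. destruct (lt_eq_lt_dec l' l) as [[Hlt|He]|Hlt]; auto.
      + destruct (H2 l' Hlt H3).
      + destruct (H4 l Hlt H1).
    - intros ->. auto. }
  (* [upto r] runs from 0, so there are [S r] colours; leaf labels are at most [r], so clipping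
     leaves them intact. *)
  exists t, g, (fun l => clip r (lab (ln l))),
    (fun p q l => S0 (proj1_sig p) (proj1_sig q) l).
  split; [|split].
  - intros x y Hxy. destruct (height_meet_total d t x y) as [[|l] Hl].
    + now apply height_meet_0 in Hl.
    + destruct (height_meet_anc nd par d root x y _ Hex Hl) as [_ H2].
      destruct (H2 0); [lia|]. simpl. fold ln. now rewrite <- !Hg, Hxy.
  - intros v. destruct (leaf_node_surj nd par d root v (Hroot v)) as [x Hx].
    exists x. apply Hnd. now rewrite Hg.
  - intros x y. rewrite Hfadj. fold (nd (g x)) (nd (g y)). unfold model_adj.
    assert (Hmin : forall z, proj1_sig (clip r (lab (ln z))) = lab (nd (g z))).
    { intros z. simpl. rewrite Hg. apply Nat.min_l. rewrite <- Hg. now apply Hleaflab. }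
    rewrite !Hmin. destruct (height_meet_total d t x y) as [l0 Hl0].
    split; intros (l & Hl & HS).
    + apply (Hmeet x y l0 Hl0) in Hl. subst. eauto.
    + exists l. split; auto. now apply (Hmeet x y l).
Qed.

(** * Tower bounds *)

Fixpoint tow (k x : nat) : nat :=
  match k with
  | 0 => x
  | S k' => 2 ^ tow k' x
  end.

Lemma tow_ge (k x : nat) : x <= tow k x.
Proof.
  induction k as [|k IH]; simpl; auto.
  pose proof (Nat.pow_gt_lin_r 2 (tow k x) ltac:(lia)). lia.
Qed.

(** Constants sink to the bottom of the tower, since [c * 2 ^ w <= 2 ^ (c - 1 + w) <= 2 ^ (c * w)]
    for [w] at least 1. *)
Lemma tow_mul (k c z : nat) : 1 <= c -> 1 <= z -> c * tow k z <= tow k (c * z).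
Proof.
  intros Hc Hz. induction k as [|k IH]; simpl; auto.
  transitivity (2 ^ (c * tow k z)); [|apply Nat.pow_le_mono_r; lia].
  pose proof (tow_ge k z). set (w := tow k z) in *.
  pose proof (Nat.pow_gt_lin_r 2 (c - 1) ltac:(lia)).
  transitivity (2 ^ (c - 1) * 2 ^ w); [apply Nat.mul_le_mono_r; lia|].
  rewrite <- Nat.pow_add_r. apply Nat.pow_le_mono_r; nia.
Qed.

(** The hypothesis on [n * 2 ^ m] survives every round, so one bound [2 ^ y] serves all type counts
    in the recursion. Each round contributes a factor [2 ^ (1 + y)], where the 1 pays for the
    successor. *)
Lemma threshold_of_bound (N : nat -> nat -> nat) (x y m n : nat) :
  (forall m' n', m' <= x -> n' * 2 ^ m' <= 2 ^ x -> N m' n' <= 2 ^ y) ->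
  m <= x -> n * 2 ^ m <= 2 ^ x -> threshold_of N m n <= 2 ^ (1 + m * (1 + y)).
Proof.
  intros HN. revert n. induction m as [|m IH]; intros n Hm Hn.
  - simpl. lia.
  - cbn [threshold_of].
    assert (Hn' : 2 * n * 2 ^ m <= 2 ^ x) by (simpl in Hn; nia).
    specialize (IH (2 * n) ltac:(lia) Hn'). specialize (HN m (2 * n) ltac:(lia) Hn').
    replace (1 + S m * (1 + y)) with (1 + (1 + m * (1 + y) + y)) by lia.
    rewrite (Nat.pow_add_r 2 1), (Nat.pow_add_r 2 _ y).
    set (a := 2 ^ (1 + m * (1 + y))) in *. set (b := 2 ^ y) in *.
    assert (1 <= a * b).
    { unfold a, b. rewrite <- Nat.pow_add_r. apply Nat.neq_0_lt_0, Nat.pow_nonzero. lia. }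
    pose proof (Nat.mul_le_mono _ _ _ _ IH HN). simpl (2 ^ 1). lia.
Qed.

Lemma quadratic_le_pow4 (y : nat) : 1 <= y -> 2 + y + y * y <= 2 ^ (2 * y).
Proof.
  intros Hy. induction y as [|y IH]; [lia|]. destruct y as [|y]; [simpl; lia|].
  replace (2 * S (S y)) with (2 + 2 * S y) by lia. rewrite Nat.pow_add_r.
  specialize (IH ltac:(lia)). simpl (2 ^ 2). nia.
Qed.

(** With [m <= x <= y] the exponent [(2 + m * (1 + y)) * 2 ^ y] is at most [2 ^ (3 * y)], because
    [2 + y + y * y <= 2 ^ (2 * y)]. Hence a factor 3 per level, which sinks to the bottom as
    [3 ^ k]. *)
Lemma num_types_bound (k m n x : nat) :
  1 <= x -> m <= x -> n * 2 ^ m <= 2 ^ x -> num_types k m n <= 2 ^ tow k (3 ^ k * x).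
Proof.
  intros Hx. revert m n. induction k as [|k IH]; intros m n Hm Hn.
  - cbn [num_types tow Nat.pow]. rewrite Nat.mul_1_l.
    assert (1 <= 2 ^ m) by (apply Nat.neq_0_lt_0, Nat.pow_nonzero; lia). nia.
  - assert (H3 : 1 <= 3 ^ k) by (apply Nat.neq_0_lt_0, Nat.pow_nonzero; lia).
    set (y := tow k (3 ^ k * x)) in *.
    assert (Hxy : x <= y) by (pose proof (tow_ge k (3 ^ k * x)); nia).
    pose proof (threshold_of_bound (num_types k) x y m n IH Hm Hn) as Ht.
    specialize (IH m n Hm Hn). cbn [num_types].
    assert (Ht' : S (threshold_of (num_types k) m n) <= 2 ^ (2 + m * (1 + y))).
    { change (2 + m * (1 + y)) with (1 + (1 + m * (1 + y))). rewrite Nat.pow_add_r.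
      assert (1 <= 2 ^ (1 + m * (1 + y))) by (apply Nat.neq_0_lt_0, Nat.pow_nonzero; lia).
      simpl (2 ^ 1). lia. }
    transitivity ((2 ^ (2 + m * (1 + y))) ^ (2 ^ y)).
    { transitivity ((2 ^ (2 + m * (1 + y))) ^ num_types k m n).
      - now apply Nat.pow_le_mono_l.
      - apply Nat.pow_le_mono_r; auto. apply Nat.pow_nonzero. lia. }
    rewrite <- Nat.pow_mul_r. apply Nat.pow_le_mono_r; [lia|].
    transitivity (2 ^ (3 * y)).
    + replace (3 * y) with (2 * y + y) by lia. rewrite Nat.pow_add_r.
      apply Nat.mul_le_mono_r. pose proof (quadratic_le_pow4 y ltac:(lia)). nia.
    + cbn [tow]. apply Nat.pow_le_mono_r; [lia|].
      replace (3 ^ S k * x) with (3 * (3 ^ k * x)) by (simpl; lia).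
      apply tow_mul; nia.
Qed.

(** At one level the exponents of type count and threshold add up to [(m + 1) * (1 + y)], at most
    twice [(m + 1) * y]; this is the origin of the factor [m + 1]. The size one level below supplies
    the third summand of [3 * tow k B]. *)
Lemma small_size_bound (k m n x : nat) :
  1 <= x -> m <= x -> n * 2 ^ m <= 2 ^ x -> small_size k m n <= tow k (3 ^ k * ((m + 1) * x)).
Proof.
  intros Hx Hm Hn. induction k as [|k IH].
  - simpl. nia.
  - assert (H3 : 1 <= 3 ^ k) by (apply Nat.neq_0_lt_0, Nat.pow_nonzero; lia).
    pose proof (num_types_bound k m n x Hx Hm Hn) as HN.
    pose proof (threshold_of_bound (num_types k) x (tow k (3 ^ k * x)) m n
                  (fun m' n' => num_types_bound k m' n' x Hx) Hm Hn) as Ht.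
    fold (threshold k) in Ht.
    assert (Hy : (m + 1) * tow k (3 ^ k * x) <= tow k (3 ^ k * ((m + 1) * x))).
    { replace (3 ^ k * ((m + 1) * x)) with ((m + 1) * (3 ^ k * x)) by lia.
      apply tow_mul; nia. }
    assert (Hxy : x <= tow k (3 ^ k * x)) by (pose proof (tow_ge k (3 ^ k * x)); nia).
    set (y := tow k (3 ^ k * x)) in *. set (B := 3 ^ k * ((m + 1) * x)) in *.
    assert (HB : tow k B <= 2 ^ tow k B)
      by (pose proof (Nat.pow_gt_lin_r 2 (tow k B) ltac:(lia)); lia).
    cbn [small_size tow].
    transitivity (2 ^ y * 2 ^ (1 + m * (1 + y)) * 2 ^ tow k B).
    { apply Nat.mul_le_mono; [now apply Nat.mul_le_mono|lia]. }
    rewrite <- !Nat.pow_add_r. apply Nat.pow_le_mono_r; [lia|].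
    replace (3 ^ S k * ((m + 1) * x)) with (3 * B) by (unfold B; simpl; lia).
    transitivity (3 * tow k B); [nia|]. apply tow_mul; unfold B; nia.
Qed.

(* Squaring [s] is absorbed by the tower only for [d > 0]; hence the last hypothesis. *)
Lemma matrix_count_bound (d s z : nat) :
  1 <= z -> s <= tow d z -> (d = 0 -> s <= 1) ->
  S s * (2 ^ S s) ^ S s <= tow (S d) (6 * z).
Proof.
  intros Hz Hs H0. rewrite <- Nat.pow_mul_r.
  transitivity (2 ^ (S s + S s * S s)).
  { rewrite Nat.pow_add_r. apply Nat.mul_le_mono_r.
    pose proof (Nat.pow_gt_lin_r 2 (S s) ltac:(lia)). lia. }
  cbn [tow]. apply Nat.pow_le_mono_r; [lia|].
  destruct d as [|d].
  (* Here [S s] is at most 2, and 2 + 2 * 2 = 6 fixes the constant. *)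
  - simpl tow. specialize (H0 eq_refl). nia.
  - cbn [tow] in *. pose proof (tow_ge d z). set (w := tow d z) in *.
    (* With [q = 2 ^ w] at least 2, [2 * q + 4 * q ^ 2 <= q ^ 6]. *)
    transitivity (2 ^ (6 * w)).
    + assert (Hw : 2 <= 2 ^ w) by (change 2 with (2 ^ 1) at 1; apply Nat.pow_le_mono_r; lia).
      replace (6 * w) with (w + w + (w + w + (w + w))) by lia. rewrite !Nat.pow_add_r.
      set (q := 2 ^ w) in *. assert (S s <= 2 * q) by lia.
      assert (S s * S s <= (2 * q) * (2 * q)) by (apply Nat.mul_le_mono; lia).
      assert (4 <= q * q) by nia. set (qq := q * q) in *.
      assert (q <= qq) by (unfold qq; nia).
      transitivity (2 * q + 4 * qq); [unfold qq in *; lia|]. nia.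
    + apply Nat.pow_le_mono_r; [lia|]. apply tow_mul; lia.
Qed.

Lemma INR_tow (k x : nat) : INR (tow k x) = tower k (INR x).
Proof.
  induction k as [|k IH]; simpl; auto. rewrite <- IH, pow_INR.
  change (INR 2) with 2%R. symmetry. apply Rpower_pow. lra.
Qed.

Lemma tower_mono (k : nat) (x y : R) : (x <= y)%R -> (tower k x <= tower k y)%R.
Proof. intros H. induction k; simpl; auto. apply Rle_Rpower; lra. Qed.

Lemma log2_le_logr (r : nat) : (INR (Nat.log2 r) <= logr r)%R.
Proof.
  unfold logr. destruct r as [|r].
  - simpl. apply Rle_trans with 1%R; [lra|apply Rmax_l].
  - eapply Rle_trans; [|apply Rmax_r].
    destruct (Nat.log2_spec (S r) ltac:(lia)) as [H _]. apply le_INR in H.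
    rewrite pow_INR in H. change (INR 2) with 2%R in H.
    assert (Hln2 : (0 < ln 2)%R) by (rewrite <- ln_1; apply ln_increasing; lra).
    apply Rmult_le_reg_r with (ln 2); auto.
    unfold Rdiv. rewrite Rmult_assoc, Rinv_l, Rmult_1_r by lra.
    rewrite <- ln_pow by lra.
    assert (Hpos : (0 < 2 ^ Nat.log2 (S r))%R) by (apply pow_lt; lra).
    destruct (Rle_lt_or_eq_dec _ _ H) as [Hlt| ->]; [left; now apply ln_increasing|lra].
Qed.

(** * Small induced subgraphs and the index *)

Lemma small_induced_subgraph (r d m : nat) (G : graph) :
  TM r d G ->
  exists H, TM r d H /\ induced_sub H G /\ fin_le (gV H) (small_size d m (S r)) /\
            mso_equiv m H G.
Proof.
  intros HG. destruct (classic (inhabited (gV G))) as [Hin|Hempty].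
  - destruct (TM_htree r d G HG Hin) as (t & f & c & adj & Hinj & Hsur & Hadj).
    destruct (small_subtree d m (S r) (upto r) t c (fin_le_upto r)) as (t' & e & Hfin & Hm & Ht).
    assert (Heinj : forall x y, e x = e y -> x = y).
    { intros x y Hxy. apply (height_meet_0 d t'), Hm. rewrite Hxy. apply height_meet_refl. }
    set (f' := fun x => f (e x)).
    assert (Hind : induced_sub (pullback G f') G).
    { exists f'. split; [intros x y H; auto|]. intros x y. reflexivity. }
    exists (pullback G f'). split; [|split; [|split]]; auto.
    (* [H] is nonempty because its tree has the type of [t], and a type shows whether there is a
       leaf. *)
    + apply (TM_induced_sub r d G); auto. destruct Hin as [v]. destruct (Hsur v) as [x _].
      destruct (type_of_exists d m (S r) (upto r) t t' c _ (fun _ => True) (eq_sym Ht)) as [x' _];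
        [eauto|]. constructor. exact x'.
    + assert (H1 : mso_equiv m (pullback G f') (pullback G f)).
      { apply (type_of_mso_equiv G G d m (S r) (upto r) t' t f' f (fun x => c (e x)) c adj);
          auto using fin_le_upto; [lia|].
        intros x y. unfold f'. rewrite (Hadj (e x) (e y)). split; intros (l & Hl & HA); exists l;
          split; auto; now apply Hm. }
      assert (H2 : mso_equiv m (pullback G f) G).
      { apply (mso_equiv_iso m (pullback G f) G f); auto. intros x y. reflexivity. }
      intros p Hp Hqr. rewrite (H1 p Hp Hqr). auto.
  (* A tree without leaves represents the empty graph, which is its own small subgraph. *)
  - exists G. split; auto. split; [|split].
    + exists (fun x => x). split; auto. tauto.
    + exists []. split; [simpl; lia|]. intros a. destruct Hempty. now constructor.
    + intros p _ _. tauto.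
Qed.

(** * Counting small graphs by their adjacency matrices *)

Lemma fin_le_listing (A : Type) (n : nat) :
  fin_le A n -> exists l : list A, NoDup l /\ (forall a, In a l) /\ length l <= n.
Proof.
  intros [l [Hl Hall]]. exists (nodup eq_dec_classic l). split; [apply NoDup_nodup|]. split.
  - intros a. now apply nodup_In.
  - etransitivity; [|exact Hl]. apply NoDup_incl_length; [apply NoDup_nodup|].
    intros a _. auto.
Qed.

(** The matrix is padded with [false] beyond the listing, so without the length it could not tell
    isolated vertices from padding. *)
Definition adjacency_code (s : nat) (G : graph) (l : list (gV G)) :
    upto s * (upto s -> upto s -> bool) :=
  (clip s (length l),
   fun a b => truth (exists u v, nth_error l (proj1_sig a) = Some u /\
                                 nth_error l (proj1_sig b) = Some v /\ gE G u v)).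

Lemma adjacency_code_equiv (s m : nat) (G G' : graph) (l : list (gV G)) (l' : list (gV G')) :
  NoDup l -> (forall v, In v l) -> length l <= s ->
  NoDup l' -> (forall v, In v l') -> length l' <= s ->
  adjacency_code s G l = adjacency_code s G' l' -> mso_equiv m G G'.
Proof.
  intros Hd Hall Hs Hd' Hall' Hs' Hcode. unfold adjacency_code in Hcode.
  injection Hcode as Hlen Hadj.
  assert (Hlen' : length l = length l') by lia.
  assert (Hf : forall u, exists u', exists a, nth_error l a = Some u /\ nth_error l' a = Some u').
  { intros u. destruct (In_nth_error l u (Hall u)) as [a Ha].
    assert (Hlt : a < length l) by (apply nth_error_Some; congruence).
    rewrite Hlen' in Hlt. apply nth_error_Some in Hlt.
    destruct (nth_error l' a) as [u'|] eqn:Eu; [|tauto]. exists u', a. auto. }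
  apply dep_choice in Hf. destruct Hf as [f Hf].
  assert (Hentry : forall a b, a < length l -> b < length l ->
    ((exists u v, nth_error l a = Some u /\ nth_error l b = Some v /\ gE G u v) <->
     (exists u v, nth_error l' a = Some u /\ nth_error l' b = Some v /\ gE G' u v))).
  { intros a b Ha Hb.
    apply (f_equal (fun F => F (clip s a) (clip s b))) in Hadj. simpl in Hadj.
    rewrite !Nat.min_l in Hadj by lia.
    eapply iff_trans; [symmetry; apply truth_iff|]. rewrite Hadj. apply truth_iff. }
  apply (mso_equiv_iso m G G' f).
  - intros x y Hxy. destruct (Hf x) as (a & Ha & Ha'). destruct (Hf y) as (b & Hb & Hb').
    assert (a = b).
    { apply (proj1 (NoDup_nth_error l') Hd'); [apply nth_error_Some; congruence|congruence]. }
    congruence.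
  - intros z. destruct (In_nth_error l' z (Hall' z)) as [a Ha].
    assert (Hlt : a < length l') by (apply nth_error_Some; congruence).
    rewrite <- Hlen' in Hlt. apply nth_error_Some in Hlt.
    destruct (nth_error l a) as [x|] eqn:Ex; [|tauto]. exists x.
    destruct (Hf x) as (b & Hb & Hb').
    assert (a = b).
    { apply (proj1 (NoDup_nth_error l) Hd); [apply nth_error_Some; congruence|congruence]. }
    congruence.
  - intros x y. destruct (Hf x) as (a & Ha & Ha'). destruct (Hf y) as (b & Hb & Hb').
    specialize (Hentry a b ltac:(apply nth_error_Some; congruence)
                           ltac:(apply nth_error_Some; congruence)).
    split; intros HE.
    + destruct (proj1 Hentry) as (u & v & Hu & Hv & HE'); [exists x, y; auto|congruence].
    + destruct (proj2 Hentry) as (u & v & Hu & Hv & HE'); [exists (f x), (f y); auto|congruence].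
Qed.

Lemma index_le_matrices (r d m n : nat) (Gs : nat -> graph) :
  (forall i, i < n -> TM r d (Gs i)) ->
  (forall i j, i < n -> j < n -> i <> j -> ~ mso_equiv m (Gs i) (Gs j)) ->
  n <= S (small_size d m (S r)) * (2 ^ S (small_size d m (S r))) ^ S (small_size d m (S r)).
Proof.
  intros HTM Hne. set (s := small_size d m (S r)).
  assert (Hrep : forall i, exists Hl : {H : graph & list (gV H)}, i < n ->
     NoDup (projT2 Hl) /\ (forall v, In v (projT2 Hl)) /\ length (projT2 Hl) <= s /\
     mso_equiv m (projT1 Hl) (Gs i)).
  { intros i. destruct (le_lt_dec n i) as [Hge|Hlt].
    - exists (existT _ (Gs i) []). lia.
    - destruct (small_induced_subgraph r d m (Gs i) (HTM i Hlt)) as (H & _ & _ & Hfin & Heq).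
      destruct (fin_le_listing _ _ Hfin) as (l & H1 & H2 & H3).
      exists (existT _ H l). auto. }
  apply dep_choice in Hrep. destruct Hrep as [rep Hrep].
  set (code := fun i => adjacency_code s (projT1 (rep i)) (projT2 (rep i))).
  assert (Hfin : fin_le (upto s * (upto s -> upto s -> bool)) (S s * (2 ^ S s) ^ S s)).
  { apply fin_le_prod; [apply fin_le_upto|]. apply fin_le_fun; [apply fin_le_upto| |].
    - apply fin_le_fun; auto using fin_le_upto, fin_le_bool.
    - apply Nat.neq_0_lt_0, Nat.pow_nonzero. lia. }
  destruct Hfin as (L & HL & Hall).
  etransitivity; [|exact HL].
  replace n with (length (map code (seq 0 n))) by now rewrite length_map, length_seq.
  apply NoDup_incl_length.
  - apply NoDup_map_NoDup_ForallPairs; [|apply seq_NoDup].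
    intros i j Hi Hj Hij. apply in_seq in Hi, Hj. apply NNPP. intros Hnij.
    apply (Hne i j); [lia|lia|auto|].
    destruct (Hrep i ltac:(lia)) as (A1 & A2 & A3 & A4).
    destruct (Hrep j ltac:(lia)) as (B1 & B2 & B3 & B4).
    pose proof (adjacency_code_equiv s m _ _ _ _ A1 A2 A3 B1 B2 B3 Hij) as HAB.
    intros p Hp Hqr. rewrite <- (A4 p Hp Hqr), <- (B4 p Hp Hqr). auto.
  - intros x _. auto.
Qed.

(* The bounds over the reals *)
Local Close Scope nat_scope.
Open Scope R_scope.

Theorem theorem7 (d r : nat) :
  exists h : nat -> nat,
    (forall a b, (a < b)%nat -> (h a < h b)%nat) /\
    forall m : nat, (1 <= m)%nat ->
      (forall G : graph, TM r d G ->
         exists H : graph,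
           TM r d H /\ induced_sub H G /\
           card_le H (tower d (INR (h d) * INR m * (INR m + logr r))) /\
           mso_equiv m H G) /\
      mso_index_le r d m (tower (S d) (INR (h d) * (INR m) ^ 2 * (logr r) ^ 2)).
Proof.
  (* 48 = 4 * 6 * 2: the 4 bounds [(m + 1) * x] in terms of [m * (m + log r)], the 6 comes from
     counting matrices, and the 2 from passing to [m ^ 2 * (log r) ^ 2]. The factor [3 ^ n] collects
     3 per level. *)
  exists (fun n => (48 * 3 ^ n)%nat). split.
  { intros a b Hab. pose proof (Nat.pow_lt_mono_r 3 a b ltac:(lia) Hab). lia. }
  intros m Hm.
  (* [x] counts the bits of a colour at the end of the game: one per round, and [Nat.log2 r + 1] for
     the [S r] initial colours. *)
  set (x := (m + (Nat.log2 r + 1))%nat). set (z := (3 ^ d * ((m + 1) * x))%nat).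
  assert (Hr : (S r <= 2 ^ (Nat.log2 r + 1))%nat).
  { destruct r as [|r]; [simpl; lia|]. rewrite Nat.add_1_r. apply Nat.log2_spec. lia. }
  assert (Hs : (small_size d m (S r) <= tow d z)%nat).
  { apply small_size_bound; unfold x; try lia. rewrite Nat.add_comm, Nat.pow_add_r.
    apply Nat.mul_le_mono_r. lia. }
  assert (H3 : (1 <= 3 ^ d)%nat) by (apply Nat.neq_0_lt_0, Nat.pow_nonzero; lia).
  assert (Hz1 : (1 <= z)%nat) by (unfold z, x; nia).
  assert (HL1 : 1 <= logr r) by apply Rmax_l.
  pose proof (log2_le_logr r) as HL.
  assert (Hm1 : 1 <= INR m) by (apply (le_INR 1); auto).
  assert (H3R : 1 <= INR (3 ^ d)) by (apply (le_INR 1); auto).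
  assert (Hz : INR z <= 4 * INR (3 ^ d) * (INR m * (INR m + logr r))).
  { unfold z, x. rewrite !mult_INR, !plus_INR. change (INR 1) with 1.
    replace (4 * INR (3 ^ d) * (INR m * (INR m + logr r)))
      with (INR (3 ^ d) * ((2 * INR m) * (2 * (INR m + logr r)))) by ring.
    pose proof (pos_INR (Nat.log2 r)).
    apply Rmult_le_compat_l; [lra|]. apply Rmult_le_compat; lra. }
  rewrite mult_INR. replace (INR 48) with 48 by (simpl; lra).
  split.
  - intros G HG.
    destruct (small_induced_subgraph r d m G HG) as (H & HT & Hi & Hfin & Heq).
    exists H. split; [auto|]. split; [auto|]. split; [|auto].
    destruct (fin_le_listing _ _ Hfin) as (l & Hd & Hall & Hlen).
    exists l. split; [auto|]. split; [auto|].
    apply Rle_trans with (INR (tow d z)); [apply le_INR; lia|].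
    rewrite INR_tow. apply tower_mono.
    assert (0 <= INR (3 ^ d) * (INR m * (INR m + logr r)))
      by (apply Rmult_le_pos; [lra|apply Rmult_le_pos; lra]).
    lra.
  - intros n Gs HTM Hne. pose proof (index_le_matrices r d m n Gs HTM Hne) as Hn.
    apply Rle_trans with (INR (tow (S d) (6 * z))).
    { apply le_INR. etransitivity; [exact Hn|]. apply matrix_count_bound; auto.
      intros ->. simpl. lia. }
    rewrite INR_tow. apply tower_mono. rewrite mult_INR. replace (INR 6) with 6 by (simpl; lra).
    (* Both [m] and [logr r] are at least 1, so each of them is at most [m * (logr r) ^ 2]. *)
    assert (Hle : INR m * (INR m + logr r) <= 2 * (INR m ^ 2 * logr r ^ 2)).
    { set (q := logr r) in *. assert (Hq : q <= q ^ 2) by (simpl; nra).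
      assert (INR m <= INR m * q ^ 2) by nra.
      assert (q <= INR m * q ^ 2) by nra.
      replace (2 * (INR m ^ 2 * q ^ 2)) with
        (INR m * (INR m * q ^ 2 + INR m * q ^ 2)) by ring.
      apply Rmult_le_compat_l; lra. }
    assert (INR (3 ^ d) * (INR m * (INR m + logr r)) <=
            INR (3 ^ d) * (2 * (INR m ^ 2 * logr r ^ 2))) by (apply Rmult_le_compat_l; lra).
    lra.
Qed.
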